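(* Let $\Omega\subseteq\mathbb{R}^N$ be a nonempty open set, let $V\in L^\infty(\Omega;\mathbb{R})$, $0<m<1$, and let $(a,b,c)\in\mathbb{C}^3$ be such that $\mathrm{Im}(a)\le0$, $\mathrm{Im}(b)<0$ and $\mathrm{Im}(c)\le0$. If $\mathrm{Re}(a)\le0$, assume further that $\mathrm{Im}(a)<0$. Let $F\in L^2(\Omega)$ and let $u\in H^1(\Omega)$ be any solution to $$-\Delta u+a|u|^{-(1-m)}u+bu+cV^2u=F\quad\text{in }L^2(\Omega)$$ with either the homogeneous Dirichlet boundary condition $u_{|\Gamma}=0$, or the homogeneous Neumann boundary condition $\frac{\partial u}{\partial\nu}_{|\Gamma}=0$ (in the Neumann case $\Omega$ is additionally assumed to have a $C^1$ boundary). Then $$\|u\|_{H^1(\Omega)}^2+\|u\|_{L^{m+1}(\Omega)}^{m+1}\le M\big(\|V\|_{L^\infty(\Omega)}^4+1\big)\|F\|_{L^2(\Omega)}^2,$$ where $M=M(|a|,|b|,|c|)$.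
   Context: All functions are complex-valued unless indicated otherwise; $\Gamma$ is the boundary of $\Omega$ and $\nu$ its outward unit normal. The expression $|u|^{-(1-m)}u$ is understood to be $0$ where $u=0$. The equation is understood in the sense of distributions on $\Omega$, with right-hand side $F\in L^2(\Omega)$. The Dirichlet condition means $u\in H^1_0(\Omega)$. The Neumann condition is understood weakly: with $f(u)=a|u|^{-(1-m)}u+bu+cV^2u$, $$\mathrm{Re}\int_\Omega\nabla u\cdot\overline{\nabla v}\,dx+\mathrm{Re}\int_\Omega f(u)\overline v\,dx=\mathrm{Re}\int_\Omega F\overline v\,dx$$ for all $v\in H^1(\Omega)$ vanishing outside a bounded set (i.e. all $v\in H^1(\Omega)$ if $\Omega$ is bounded). The notation $M=M(p_1,\dots,p_n)$ means that the positive constant $M$ depends continuously and only on $p_1,\dots,p_n$.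
   Formalization: The constant M is taken as a continuous function of the admissible (a,b,c) instead of (|a|,|b|,|c|); with the moduli alone the claim fails, e.g. for constant u on ]0,1[ with Neumann condition, a=1, c=0, |b|=2 and Im(b) tending to 0. *)

(* Defs.v *)
From HB Require Import structures.
From mathcomp Require Import all_boot all_order all_algebra.
From mathcomp Require Import all_classical all_reals all_analysis.
From mathcomp Require Import complex.

Set Implicit Arguments.
Unset Strict Implicit.
Unset Printing Implicit Defensive.

Import Order.TTheory GRing.Theory Num.Theory.
Import numFieldNormedType.Exports.
Import ComplexField.Normc.

Local Open Scope classical_set_scope.
Local Open Scope ring_scope.
Local Open Scope complex_scope.

(* The Borel sigma-algebra of R^n, generated by the coordinate maps. *)

Definition measure_rV_display : measure_display.
Proof. exact: default_measure_display. Qed.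

Section measurable_rV.
Context {R : realType} (n : nat).

Definition rV_coord (i : 'I_n) (x : 'rV[R]_n) : measurableTypeR R := x ord0 i.

Let rV_set0 : g_sigma_preimage rV_coord set0.
Proof. exact: sigma_algebra0. Qed.

Let rV_setC A : g_sigma_preimage rV_coord A ->
  g_sigma_preimage rV_coord (~` A).
Proof. exact: sigma_algebraC. Qed.

Let rV_bigcup (F : _^nat) : (forall i, g_sigma_preimage rV_coord (F i)) ->
  g_sigma_preimage rV_coord (\bigcup_i (F i)).
Proof. exact: sigma_algebra_bigcup. Qed.

HB.instance Definition _ := @isMeasurable.Build measure_rV_display
  'rV[R]_n (g_sigma_preimage rV_coord) rV_set0 rV_setC rV_bigcup.

Lemma measurable_rV_coord i : measurable_fun [set: 'rV[R]_n] (rV_coord i).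
Proof.
move=> _ Y mY; rewrite setTI; apply: sub_sigma_algebra => /=.
rewrite -bigcup_seq/=; exists i => /=; first by rewrite mem_index_enum.
by exists Y => //; rewrite setTI.
Qed.

Lemma measurable_fun_rVP d (T : measurableType d) (f : T -> 'rV[R]_n) :
  measurable_fun [set: T] f <->
  forall i, measurable_fun [set: T] (rV_coord i \o f).
Proof.
split=> [mf i|mf].
  by apply: measurableT_comp => //; exact: measurable_rV_coord.
suff : g_sigma_preimage (fun i => rV_coord i \o f) `<=` measurable.
  rewrite g_sigma_preimage_comp => prefS _ A mA.
  by apply: prefS; exists A.
apply: smallest_sub; first exact: sigma_algebra_measurable.
rewrite -bigcup_seq/=; apply: bigcup_sub => i _ A [B mB <-].
exact: mf.
Qed.

End measurable_rV.

Section lebesgue_rV_step.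
Context {R : realType} {n : nat}.
Variable mu : {sigma_finite_measure set 'rV[R]_n -> \bar R}.

Definition rV_cons (p : measurableTypeR R * 'rV[R]_n) : 'rV[R]_n.+1 :=
  row_mx (p.1)%:M p.2.

Definition rV_uncons (x : 'rV[R]_(1 + n)) : measurableTypeR R * 'rV[R]_n :=
  (lsubmx x ord0 ord0, rsubmx x).

Lemma rV_consK : cancel rV_cons rV_uncons.
Proof.
move=> [a y]; rewrite /rV_cons /rV_uncons/= row_mxKl row_mxKr.
by rewrite mxE mulr1n.
Qed.

Lemma measurable_rV_cons : measurable_fun setT rV_cons.
Proof.
apply/measurable_fun_rVP => i.
case: (splitP (i : 'I_(1 + n))) => j ij.
  rewrite (_ : _ \o _ = fst) //; apply/funext => -[a y] /=.
  rewrite /rV_coord /rV_cons (_ : i = lshift n j); last exact/val_inj.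
  by rewrite [LHS](@row_mxEl R 1 1 n) !ord1 mxE mulr1n.
rewrite (_ : _ \o _ = rV_coord j \o snd); last first.
  apply/funext => -[a y] /=.
  rewrite /rV_coord /rV_cons (_ : i = rshift 1 j); last exact/val_inj.
  by rewrite [LHS](@row_mxEr R 1 1 n).
by apply: measurableT_comp => //; exact: measurable_rV_coord.
Qed.

Lemma measurable_rV_uncons :
  measurable_fun setT (rV_uncons : 'rV[R]_n.+1 -> _).
Proof.
apply: measurable_fun_pair.
  rewrite (_ : (fun x : 'rV[R]_n.+1 => _) = @rV_coord R n.+1 (@lshift 1 n ord0)).
    exact: measurable_rV_coord.
  by apply/funext => x; rewrite mxE.
apply/measurable_fun_rVP => i.
rewrite (_ : _ \o _ = @rV_coord R n.+1 (rshift 1 i)); first exact: measurable_rV_coord.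
by apply/funext => x /=; rewrite /rV_coord mxE.
Qed.

Definition lebesgue_rV_step : set 'rV[R]_n.+1 -> \bar R :=
  pushforward ((@lebesgue_measure R) \x mu)%E rV_cons.

Let lebesgue_rV_step0 : lebesgue_rV_step set0 = 0%E.
Proof. by rewrite /lebesgue_rV_step /pushforward preimage_set0 measure0. Qed.

Let lebesgue_rV_step_ge0 A : (0 <= lebesgue_rV_step A)%E.
Proof. by rewrite /lebesgue_rV_step /pushforward measure_ge0. Qed.

Let lebesgue_rV_step_sigma_additive : semi_sigma_additive lebesgue_rV_step.
Proof.
move=> F mF tF mUF; rewrite /lebesgue_rV_step /pushforward preimage_bigcup.
apply: measure_semi_sigma_additive.
- by move=> k; rewrite -[X in measurable X]setTI; exact: measurable_rV_cons.
- apply/trivIsetP => /= i j _ _ ij; rewrite -preimage_setI.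
  by move/trivIsetP : tF => /(_ _ _ _ _ ij) ->//; rewrite preimage_set0.
- rewrite -preimage_bigcup -[X in measurable X]setTI.
  exact: measurable_rV_cons.
Qed.

HB.instance Definition _ := isMeasure.Build _ _ _ lebesgue_rV_step
  lebesgue_rV_step0 lebesgue_rV_step_ge0 lebesgue_rV_step_sigma_additive.

Let sigma_finite_step : sigma_finite [set: 'rV[R]_n.+1] lebesgue_rV_step.
Proof.
have /sigma_finiteP[F [TF ndF Foo]] := sigma_finiteT (@lebesgue_measure R).
have /sigma_finiteP[G [TG ndG Goo]] := sigma_finiteT mu.
exists (fun k => (rV_uncons : 'rV[R]_n.+1 -> _) @^-1` (F k `*` G k)).
  apply/esym/seteqP; split=> // x _.
  have : [set: measurableTypeR R] (rV_uncons x).1 by [].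
  rewrite TF => -[i _ Fi].
  have : [set: 'rV[R]_n] (rV_uncons x).2 by [].
  rewrite TG => -[j _ Gj].
  exists (maxn i j) => //; split.
    exact: (subsetPset _ _ (ndF _ _ (leq_maxl i j))).
  exact: (subsetPset _ _ (ndG _ _ (leq_maxr i j))).
move=> k; have [mF Fk] := Foo k; have [mG Gk] := Goo k; split.
  rewrite -[X in measurable X]setTI; apply: measurable_rV_uncons => //.
  exact: measurableX.
rewrite /lebesgue_rV_step /pushforward -comp_preimage.
rewrite (_ : rV_uncons \o rV_cons = id) ?preimage_id; last first.
  by apply/funext => p; exact: rV_consK.
by rewrite product_measure1E// lte_mul_pinfty// ge0_fin_numE.
Qed.

HB.instance Definition _ :=
  @Measure_isSigmaFinite.Build _ _ _ lebesgue_rV_step sigma_finite_step.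

End lebesgue_rV_step.

Fixpoint lebesgue_rV {R : realType} (n : nat) :
    {sigma_finite_measure set 'rV[R]_n -> \bar R} :=
  if n is k.+1 then lebesgue_rV_step (lebesgue_rV k)
  else dirac (0 : 'rV[R]_0).

(* This box formula characterises Lebesgue measure on R^n. *)
Lemma lebesgue_rV_box {R : realType} n (A : 'I_n -> set (measurableTypeR R)) :
  (forall i, measurable (A i)) ->
  lebesgue_rV n [set x | forall i, A i (x ord0 i)] =
  (\prod_(i < n) (@lebesgue_measure R) (A i))%E.
Proof.
elim: n A => [|n IH] A mA.
  by rewrite big_ord0 /= diracE mem_set// => -[].
rewrite big_ord_recl -IH // -product_measure1E//; last first.
  rewrite [X in measurable X](_ : _ = \bigcap_(i in [set: 'I_n])
      @rV_coord R n i @^-1` A (lift ord0 i)).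
    apply: fin_bigcap_measurable => // i _.
    rewrite -[X in measurable X]setTI.
    exact: measurable_rV_coord.
  by apply/seteqP; split=> [x Ax i _ //|x Ax i]; exact: Ax.
rewrite /= /lebesgue_rV_step /pushforward; congr (product_measure1 _ _ _).
apply/seteqP; split=> -[a y] /= => [Ay|[Aa Ay] i].
  split=> [|i].
    have := Ay (@lshift 1 n ord0).
    rewrite /rV_cons [X in A _ X](@row_mxEl R 1 1 n) mxE mulr1n.
    by rewrite (_ : lshift n 0 = ord0)//; exact/val_inj.
  have := Ay (rshift 1 i); rewrite /rV_cons [X in A _ X](@row_mxEr R 1 1 n).
  by rewrite (_ : rshift 1 i = lift ord0 i)//; exact/val_inj.
case: (splitP (i : 'I_(1 + n))) => j ij.
  rewrite (_ : i = lshift n j); last exact/val_inj.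
  rewrite /rV_cons [X in A _ X](@row_mxEl R 1 1 n) !ord1 mxE mulr1n.
  by rewrite (_ : lshift n 0 = ord0)//; exact/val_inj.
rewrite (_ : i = rshift 1 j); last exact/val_inj.
rewrite /rV_cons [X in A _ X](@row_mxEr R 1 1 n).
by rewrite (_ : rshift 1 j = lift ord0 j)//; exact/val_inj.
Qed.

(* the metric topology of R[i] given by its modulus *)
HB.instance Definition _ (R : realType) :=
  PseudoPointedMetric.copy R[i] (R[i])^o.

Section sobolev.
Context {R : realType} {N : nat}.
Local Notation E := 'rV[R]_N.
Local Notation C := R[i].
Local Notation mu := (@lebesgue_rV R N).
Implicit Types (Om : set E) (u v g f F phi : E -> C) (Du Dv : 'I_N -> E -> C).

Definition Cintegral Om f : C :=
  (\int[mu]_(x in Om) complex.Re (f x)) +i*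
  (\int[mu]_(x in Om) complex.Im (f x)).

Definition normL Om (p : \bar R) f : \bar R :=
  Lnorm mu p (EFin \o ((fun x => normc (f x)) \_ Om)).

Definition memL Om (p : \bar R) f : Prop :=
  [/\ measurable_fun Om (fun x => complex.Re (f x)),
      measurable_fun Om (fun x => complex.Im (f x)) &
      (normL Om p f < +oo)%E].

Definition basis_rV {n} (i : 'I_n) : 'rV[R]_n := delta_mx 0 i.

Fixpoint Ck {n} (k : nat) (h : 'rV[R]_n -> R) : Prop :=
  continuous h /\
  if k is k'.+1 then
    (forall i x, derivable h x (basis_rV i)) /\
    (forall i, Ck k' (fun x => 'D_(basis_rV i) h x))
  else True.

Definition partial (i : 'I_N) phi : E -> C := fun x =>
  ('D_(basis_rV i) (fun y => complex.Re (phi y)) x) +i*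
  ('D_(basis_rV i) (fun y => complex.Im (phi y)) x).

Definition laplacian phi : E -> C := fun x =>
  \sum_i partial i (partial i phi) x.

(* C_c^oo(Om; C) *)
Definition test_function Om phi : Prop :=
  [/\ forall k, Ck k (fun y => complex.Re (phi y)),
      forall k, Ck k (fun y => complex.Im (phi y)) &
      exists K, [/\ compact K, K `<=` Om & forall x, ~ K x -> phi x = 0]].

Definition weak_partial Om (i : 'I_N) u g : Prop :=
  forall phi, test_function Om phi ->
    Cintegral Om (fun x => u x * partial i phi x) =
    - Cintegral Om (fun x => g x * phi x).

(* Functions are Borel representatives modulo null sets; only their values on
   Om matter.  The weak gradient is carried along explicitly: [H1 Om u Du]
   reads "u belongs to H^1(Om) and Du is (a version of) its gradient". *)
Definition H1 Om u Du : Prop :=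
  memL Om 2%:E u /\
  forall i, memL Om 2%:E (Du i) /\ weak_partial Om i u (Du i).

Definition sqnormH1 Om u Du : \bar R :=
  (normL Om 2%:E u ^+ 2 + \sum_i normL Om 2%:E (Du i) ^+ 2)%E.

(* the closure of the test functions in H^1(Om) *)
Definition H10 Om u Du : Prop :=
  H1 Om u Du /\
  forall e : R, 0 < e -> exists phi, test_function Om phi /\
    (sqnormH1 Om (u \- phi)%R (fun i => Du i \- partial i phi)%R < e%:E)%E.

(* Near each boundary point, Om is the strict epigraph of a C^1 function of
   N-1 of the coordinates, up to relabelling and reorienting the axes. *)
Definition C1_boundary Om : Prop :=
  forall x0 : E, (closure Om `\` interior Om) x0 ->
  exists (r : R) (i : 'I_N) (s : bool) (gamma : 'rV[R]_N.-1 -> R),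
    [/\ 0 < r, Ck 1 gamma &
        forall x, ball x0 r x ->
          (Om x <-> gamma (col' i x) < (-1) ^+ s * x ord0 i)].

Section equation.
Variables (Om : set E) (V : E -> R) (m : R) (a b c : C).

(* a |u|^{-(1-m)} u + b u + c V^2 u; the first term vanishes where u = 0. *)
Definition nonlinearity u : E -> C := fun x =>
  a * (normc (u x) `^ (- (1 - m)))%:C * u x + b * u x
  + c * ((V x) ^+ 2)%:C * u x.

(* - Delta u + f(u) = F in the sense of distributions *)
Definition distributional_solution u F : Prop :=
  forall phi, test_function Om phi ->
    - Cintegral Om (fun x => u x * laplacian phi x)
    + Cintegral Om (fun x => nonlinearity u x * phi x)
    = Cintegral Om (fun x => F x * phi x).

Definition neumann u Du F : Prop :=
  forall v Dv, H1 Om v Dv ->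
    (exists r : R, forall x, Om x -> r < `|x| -> v x = 0) ->
    complex.Re (Cintegral Om (fun x => \sum_i Du i x * (Dv i x)^*))
    + complex.Re (Cintegral Om (fun x => nonlinearity u x * (v x)^*))
    = complex.Re (Cintegral Om (fun x => F x * (v x)^*)).

End equation.

End sobolev.

(* The constraints on the coefficients bound |Im b|, and one of Re a and |Im a|,
   away from 0 only locally: constants blow up at the boundary of this set even
   when |a|, |b|, |c| stay fixed or converge.  E.g. on Om = ]0,1[ with the
   Neumann condition, u = 1 solves the equation for a = 1, b = -1 - i e, c = 0
   and F = - i e, so that ||u||^2 / ||F||^2 = e^-2. *)
Definition admissible {R : realType} (a b c : R[i]) : Prop :=
  [/\ complex.Im a <= 0, complex.Im b < 0, complex.Im c <= 0 &
      complex.Re a <= 0 -> complex.Im a < 0].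

(* Main.v *)
Require Import Defs.
From HB Require Import structures.
From mathcomp Require Import all_boot all_order all_algebra.
From mathcomp Require Import all_classical all_reals all_analysis.
From mathcomp Require Import measurable_realfun ess_sup_inf complex ring lra.

Set Implicit Arguments.
Unset Strict Implicit.
Unset Printing Implicit Defensive.

Import Order.TTheory GRing.Theory Num.Theory.
Import numFieldNormedType.Exports.
Import ComplexField.Normc.

Local Open Scope classical_set_scope.
Local Open Scope ring_scope.
Local Open Scope complex_scope.

(** The proof tests the equation with [theta * chi * u], where [theta = 1 - i lam]
    for a large real [lam] and [chi] is a smooth cutoff. Without the cutoff, and
    writing [q] for the integral of [|u|^(m+1)], the real part of the resulting
    identity is

      |grad u|^2 + (Re a - lam Im a) q + (Re b - lam Im b) |u|^2
        + (Re c - lam Im c) |V u|^2 = Re ((1 + i lam) (F, u)),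

    the norms and the product being those of L^2. As [Im a], [Im c] are
    nonpositive and [Im b] is negative, a large [lam] makes all coefficients
    nonnegative up to the term in [c], which is at least [- |Re c| |V|_oo^2 |u|^2]
    and is absorbed by the term in [b]; Young's inequality absorbs the right-hand
    side. For this [lam] has to be of order [1 + |V|_oo^2], and the price is the
    factor [1 + lam^2] in front of [|F|^2], whence the fourth power of the norm of
    [V]. Since [a] is not a nonpositive real number, [|a| + Re a > 0], and
    [lam >= - Im a / (|a| + Re a)] makes the coefficient of [q] at least [|a|]
    whatever the sign of [Re a]; this yields a constant that is continuous in
    [(a, b, c)] ([multiplier], [stability_constant]).

    The cutoff is needed because [u] is not assumed to be in L^(m+1): on an
    unbounded domain [|u|^m] need not be square integrable, and the weak
    formulations only admit test functions of bounded support. With a cutoff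
    [chi_n] of radius [n + 1] everything is integrable, at the price of terms
    containing the gradient of [chi_n], which is [O(1 / n)]; Fatou's lemma
    concludes ([energy_estimate]). The cutoffs are built from [exp(-1/s)], and
    are smooth because multiplying by them has to preserve test functions.

    The two boundary conditions enter only through the vanishing of the localized
    energy. In the Neumann case the product above is itself admissible, by the
    product rule for weak derivatives ([neumann_energy_eq0]). In the Dirichlet
    case [u] is replaced by test functions converging to it in H^1, for which the
    equation holds in the sense of distributions ([dirichlet_energy_eq0]). *)

(** * Smooth cutoff functions *)

Section directional_chain_rule.
Context {R : realType} {V : normedModType R}.

Lemma is_derive_line (f : V -> R) x v d :
  is_derive x v f d <-> is_derive (0 : R) 1 (fun t : R => f (t *: v + x)) d.
Proof.
have E : 'D_1 (fun t : R => f (t *: v + x)) 0 = 'D_v f x.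
  rewrite /derive; set g1 := fun h => h^-1 *: _; set g2 := fun h => h^-1 *: _.
  suff -> : g1 = g2 by [].
  by apply/funext => h; rewrite /g1 /g2 /= addr0 scale0r add0r [_%:A]mulr1.
split=> -[fv fd]; split; rewrite -?fd ?E //.
  exact: (derivable1P f x v).1.
exact: (derivable1P f x v).2.
Qed.

(** Only directional derivatives are at hand, so there is no differential of [f]
    to compose with; on the line [t |-> t *: v + x] the one-variable chain rule
    applies. *)
Lemma is_derive_comp1 (h : R -> R) (f : V -> R) x v dh df :
  is_derive (f x) 1 h dh -> is_derive x v f df ->
  is_derive x v (h \o f) (dh * df).
Proof.
move=> hd /is_derive_line fd; apply/is_derive_line.
apply: (@is_derive1_comp R h (fun t => f (t *: v + x))).
by rewrite scale0r add0r.
Qed.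

End directional_chain_rule.

Section Ck_theory.
Context {R : realType} {n : nat}.
Implicit Types f g : 'rV[R]_n -> R.

Lemma Ck_continuous k f : Ck k f -> continuous f.
Proof. by case: k => [|k] []. Qed.

Lemma eq_Ck k f g : f =1 g -> Ck k f -> Ck k g.
Proof. by move=> /funext ->. Qed.

Lemma CkW k f : Ck k.+1 f -> Ck k f.
Proof.
elim: k f => [|k IH] f [cf [df Df]]; first by split.
by split=> //; split=> // i; exact/IH/Df.
Qed.

Lemma Ck_cst k (r : R) : Ck k (fun _ : 'rV[R]_n => r).
Proof.
elim: k r => [|k IH] r; split=> //; try exact: cst_continuous.
split=> [i x|i]; first exact: derivable_cst.
apply: (@eq_Ck _ (fun _ => 0)); last exact: IH.
by move=> x; rewrite derive_cst.
Qed.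

Lemma is_derive_coord (j : 'I_n) x (v : 'rV[R]_n) :
  is_derive x v (fun y => y ord0 j) (v ord0 j).
Proof.
apply/is_derive_line.
have h : is_derive (0 : R) 1 ((v ord0 j \*: (@id R)) + cst (x ord0 j))
    (v ord0 j).
  apply: (is_derive_eq (is_deriveD (is_deriveZ _ (is_derive_id _ _))
    (is_derive_cst _ _ _))).
  by rewrite addr0 [LHS]mulr1.
rewrite (_ : (fun t => _) = ((v ord0 j \*: (@id R)) + cst (x ord0 j)))//.
by apply/funext => t; rewrite !mxE mulrC.
Qed.

Lemma Ck_coord k (j : 'I_n) : Ck k (fun x : 'rV[R]_n => x ord0 j).
Proof.
case: k => [|k]; split=> //; try exact: coord_continuous.
split=> [i x|i]; first by have [] := is_derive_coord j x (basis_rV i).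
apply: (@eq_Ck _ (fun _ => basis_rV i ord0 j)); last exact: Ck_cst.
by move=> x; have [] := is_derive_coord j x (basis_rV i).
Qed.

Lemma CkD k f g : Ck k f -> Ck k g -> Ck k (fun x => f x + g x).
Proof.
elim: k f g => [|k IH] f g fk gk.
  split=> // x; apply: (@continuousD _ _ _ f g);
    [exact: (Ck_continuous fk)|exact: (Ck_continuous gk)].
split.
  move=> x; apply: (@continuousD _ _ _ f g);
    [exact: (Ck_continuous fk)|exact: (Ck_continuous gk)].
have [_ [df Df]] := fk; have [_ [dg Dg]] := gk.
split=> [i x|i]; first exact: derivableD.
apply: (@eq_Ck _ (fun x => 'D_(basis_rV i) f x + 'D_(basis_rV i) g x)).
  by move=> x; rewrite -deriveD.
by apply: IH; [exact: Df|exact: Dg].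
Qed.

Lemma CkM k f g : Ck k f -> Ck k g -> Ck k (fun x => f x * g x).
Proof.
elim: k f g => [|k IH] f g fk gk.
  split=> // x; apply: (@continuousM _ _ f g);
    [exact: (Ck_continuous fk)|exact: (Ck_continuous gk)].
have [cf [df Df]] := fk; have [cg [dg Dg]] := gk; split.
  by move=> x; apply: (@continuousM _ _ f g); [exact: cf|exact: cg].
split=> [i x|i]; first exact: derivableM.
apply: (@eq_Ck _
    (fun x => f x * 'D_(basis_rV i) g x + g x * 'D_(basis_rV i) f x)).
  by move=> x; rewrite -[LHS]/(_ *: _ + _ *: _) -deriveM.
by apply: CkD; apply: IH; [exact: CkW|exact: Dg|exact: CkW|exact: Df].
Qed.

Lemma CkN k f : Ck k f -> Ck k (fun x => - f x).
Proof.
move=> fk; apply: (@eq_Ck _ (fun x => (-1) * f x)).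
  by move=> x; rewrite mulN1r.
by apply: CkM => //; exact: Ck_cst.
Qed.

Lemma Ck_sum k (I : Type) (s : seq I) (f : I -> 'rV[R]_n -> R) :
  (forall i, Ck k (f i)) -> Ck k (fun x => \sum_(i <- s) f i x).
Proof.
move=> fk; elim: s => [|i s IH].
  by apply: (@eq_Ck _ (fun _ => 0)) => [x|]; [rewrite big_nil|exact: Ck_cst].
apply: (@eq_Ck _ (fun x => f i x + \sum_(j <- s) f j x)).
  by move=> x; rewrite big_cons.
exact: CkD.
Qed.

Lemma Ck_partial k i f : Ck k.+1 f -> Ck k (fun x => 'D_(basis_rV i) f x).
Proof. by case=> _ [_ +]; exact. Qed.

Lemma Ck_derivable i f x : Ck 1 f -> derivable f x (basis_rV i).
Proof. by case=> _ [+ _]; exact. Qed.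

End Ck_theory.

Section flat_functions.
Context {R : realType}.
Implicit Types (k : nat) (s : R).

(** All the [s^-k exp(-1/s)] together, rather than [exp(-1/s)] alone: the
    derivative of each one is a linear combination of the next two, so that
    infinite differentiability is an induction over the whole family. *)
Definition flat k s : R := if 0 < s then s^-1 ^+ k * expR (- s^-1) else 0.

Lemma flat_ge0 k s : 0 <= flat k s.
Proof.
rewrite /flat; case: ifPn => // s0.
by rewrite mulr_ge0 ?expR_ge0// exprn_ge0// invr_ge0 ltW.
Qed.

Lemma expXN_le k (t : R) : 0 <= t -> t ^+ k * expR (- t) <= k`!%:R.
Proof.
move=> t0; rewrite expRN ler_pdivrMr ?expR_gt0//.
case: k => [|k]; first by rewrite expr0 fact0 mul1r -expR0 ler_expR.
have /(le_trans _) := expR_ge1Dxn k t0.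
move=> /(_ (t ^+ k.+1 / k.+1`!%:R)); rewrite lerDr ler01 => /(_ isT).
by rewrite ler_pdivrMr ?ltr0n ?fact_gt0// mulrC.
Qed.

Lemma flat_le k s : flat k s <= k`!%:R.
Proof.
rewrite /flat; case: ifPn => // s0.
by apply: expXN_le; rewrite invr_ge0 ltW.
Qed.

(** Quadratic decay at 0 forces the derivative to exist and vanish there. *)
Lemma flat_le_sqr k s : flat k s <= (k.+2)`!%:R * s ^+ 2.
Proof.
rewrite /flat; case: ifPn => [s0|_]; last first.
  by rewrite mulr_ge0// sqr_ge0.
rewrite -ler_pdivrMr ?exprn_gt0// mulrAC -exprVn -exprD addn2.
by apply: expXN_le; rewrite invr_ge0 ltW.
Qed.

Lemma is_derive_flat k s :
  is_derive s 1 (flat k) (flat k.+2 s - k%:R * flat k.+1 s).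
Proof.
have [s0|s0|->] := ltgtP s 0.
- have -> : flat k.+2 s - k%:R * flat k.+1 s = 0.
    by rewrite /flat !ltNge (ltW s0) /= mulr0 subr0.
  apply: (near_eq_is_derive (f := cst 0)).
  near=> t; rewrite /flat /= ifN// -leNgt ltW//.
  by near: t; exact: lt_nbhsl.
- apply: (near_eq_is_derive
      (f := (fun t : R => t^-1) ^+ k * (expR \o (- (fun t : R => t^-1))))).
    near=> t; rewrite /flat ifT; last by near: t; exact: lt_nbhsr.
    by rewrite -[LHS]/(((fun t : R => t^-1) ^+ k) t * _) exprfctE.
  have sV : is_derive s 1 (fun t : R => t^-1) (- s ^- 2).
    apply: (is_derive_eq (@is_deriveV R id s 1 1 (lt0r_neq0 s0) _)).
    by rewrite [LHS]mulr1.
  have se := @is_derive1_comp R expR (- (fun t : R => t^-1)) s _ _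
    (is_derive_expR (- s^-1)) (is_deriveN sV).
  apply: (is_derive_eq (is_deriveM (is_deriveX k sV) se)).
  rewrite /flat s0 /= exprfctE /= opprK -exprVn.
  rewrite -[LHS]/(_ * _ + _ * _) -[_ *: _]/(_ * _).
  by case: k => [|k] /=; rewrite ?mul0r ?mulr0 ?expr0 ?exprS; ring.
- have -> : flat k.+2 (0 : R) - k%:R * flat k.+1 0 = 0.
    by rewrite /flat ltxx mulr0 subr0.
  have lim0 : (fun h : R => h^-1 *: (flat k (h *: 1 + 0) - flat k 0)) @ 0^'
      --> (0 : R).
    apply/cvgr0Pnorm_lt => e e0; near=> h.
    have h0 : h != 0 by near: h; exact: nbhs_dnbhs_neq.
    rewrite [h *: 1]mulr1 addr0 [X in _ - X]/flat ltxx subr0.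
    rewrite normrM normfV ger0_norm ?flat_ge0// mulrC ltr_pdivrMr ?normr_gt0//.
    rewrite (le_lt_trans (flat_le_sqr _ _))// -real_normK ?num_real//.
    rewrite expr2 mulrA ltr_pM2r ?normr_gt0// -ltr_pdivlMl ?ltr0n ?fact_gt0//.
    near: h; apply: dnbhs0_lt.
    by rewrite mulr_gt0 ?invr_gt0 ?ltr0n ?fact_gt0.
  by split; [apply/cvg_ex; exists 0|exact: cvg_lim].
Unshelve. all: by end_near. Qed.

Lemma flat_continuous k : continuous (flat k).
Proof.
move=> s; apply/differentiable_continuous/derivable1_diffP.
by have [] := is_derive_flat k s.
Qed.

(** The induction on [k] needs all the members [j] of the family at once, since
    differentiating shifts [j]. *)
Lemma Ck_flat_comp n k j (f : 'rV[R]_n -> R) :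
  (forall l, Ck l f) -> Ck k (fun x => flat j (f x)).
Proof.
move=> fk; have cf := Ck_continuous (fk 0%N).
have cfl l : continuous (fun x => flat l (f x)).
  by move=> x; apply: continuous_comp; [exact: cf|exact: flat_continuous].
elim: k j => [|k IH] j; split=> //.
have D (i : 'I_n) x : is_derive x (basis_rV i) (fun x => flat j (f x))
    ((flat j.+2 (f x) - j%:R * flat j.+1 (f x)) * 'D_(basis_rV i) f x).
  apply: (is_derive_comp1 (is_derive_flat j (f x))); apply: derivableP.
  by apply: Ck_derivable; exact: (fk 1%N).
split=> [i x|i]; first by have [] := D i x.
apply: (@eq_Ck _ _ _ (fun x => (flat j.+2 (f x) - j%:R * flat j.+1 (f x)) *
   'D_(basis_rV i) f x)); first by move=> x; have [] := D i x.
apply: CkM; last exact: Ck_partial.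
by apply: CkD => //; apply: CkN; apply: CkM => //; exact: Ck_cst.
Qed.

End flat_functions.

Section cutoff.
Context {R : realType} {N : nat}.
Local Notation E := 'rV[R]_N.
Implicit Types (n : nat) (x : E).

(** Positive exactly on the open ball of radius [n + 1]; the shift by one keeps
    the denominators nonzero. *)
Definition paraboloid n x : R := 1 - \sum_i (x ord0 i) ^+ 2 / n.+1%:R ^+ 2.

(** A smooth bump supported in the ball of radius [n + 1], of maximal value 1 at
    the origin. *)
Definition cutoff n x : R := flat 0 (paraboloid n x) / flat 0 1.

Lemma Ck_paraboloid n k : Ck k (paraboloid n).
Proof.
apply: CkD; first exact: Ck_cst.
apply: CkN; apply: Ck_sum => i; apply: CkM; last exact: Ck_cst.
by apply: CkM; exact: Ck_coord.
Qed.

Lemma Ck_cutoff n k : Ck k (cutoff n).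
Proof.
by apply: CkM; [apply: Ck_flat_comp => l; exact: Ck_paraboloid|exact: Ck_cst].
Qed.

Lemma flat0_gt0 : 0 < flat 0 (1 : R).
Proof. by rewrite /flat ltr01 expr0 mul1r expR_gt0. Qed.

Lemma cutoff_ge0 n x : 0 <= cutoff n x.
Proof. by rewrite divr_ge0 ?flat_ge0. Qed.

Lemma paraboloid_le1 n x : paraboloid n x <= 1.
Proof.
rewrite lerBlDr lerDl sumr_ge0// => i _.
by rewrite divr_ge0 ?sqr_ge0.
Qed.

Lemma cutoff_le1 n x : cutoff n x <= 1.
Proof.
rewrite ler_pdivrMr ?flat0_gt0// mul1r.
have p1 := paraboloid_le1 n x; rewrite /flat ltr01 !expr0 !mul1r.
case: ifPn => p0; last exact: expR_ge0.
by rewrite ler_expR lerN2 lef_pV2 ?posrE.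
Qed.

Lemma paraboloid_le0 n x i : n.+1%:R <= `|x ord0 i| -> paraboloid n x <= 0.
Proof.
move=> nx; rewrite subr_le0 (bigD1 i)//= -[leLHS]addr0 lerD//.
  rewrite ler_pdivlMr ?exprn_gt0// mul1r -[leRHS]real_normK ?num_real//.
  by rewrite lerXn2r ?nnegrE.
by rewrite sumr_ge0// => j _; rewrite divr_ge0 ?sqr_ge0.
Qed.

Lemma cutoff_eq0 n x i : n.+1%:R <= `|x ord0 i| -> cutoff n x = 0.
Proof.
by move=> /paraboloid_le0 p0; rewrite /cutoff /flat ltNge p0 mul0r.
Qed.

Lemma cutoff_cvg x : cutoff n x @[n --> \oo] --> (1 : R).
Proof.
rewrite -[X in _ --> X](@divff _ (flat 0 1 : R)) ?gt_eqF ?flat0_gt0//.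
apply: cvgM; last exact: cvg_cst.
apply: (@cvg_comp _ _ _ (paraboloid ^~ x) (flat 0) _ (nbhs (1 : R))); last first.
  exact: flat_continuous.
rewrite (_ : paraboloid ^~ x =
    fun n => 1 - (\sum_i (x ord0 i) ^+ 2) * (harmonic n * harmonic n)).
  have h := @cvg_harmonic R.
  have := cvgB (cvg_cst (1 : R))
    (cvgM (cvg_cst (\sum_i (x ord0 i) ^+ 2)) (cvgM h h)).
  by rewrite !mulr0 subr0; apply.
apply/funext => n; rewrite /paraboloid -mulr_suml; congr (_ - _ * _).
by rewrite /harmonic /= -invfM -expr2.
Qed.

Lemma is_derive_paraboloid n x i : is_derive x (basis_rV i) (paraboloid n)
  (- (2 * x ord0 i / n.+1%:R ^+ 2)).
Proof.
pose c : R := n.+1%:R ^- 2.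
have Dj (j : 'I_N) : is_derive x (basis_rV i)
    (c \*: ((fun y : E => y ord0 j) * (fun y : E => y ord0 j)))
    (c * (2 * x ord0 j * (i == j)%:R)).
  have D1 := is_derive_coord j x (basis_rV i).
  apply: (is_derive_eq (is_deriveZ _ (is_deriveM D1 D1))).
  rewrite /basis_rV mxE eqxx /= [j == i]eq_sym -[LHS]/(_ * (_ * _ + _ * _)).
  by ring.
have D := is_deriveB (is_derive_cst (1 : R) x (basis_rV i)) (is_derive_sum Dj).
have -> : paraboloid n = cst 1 - \sum_(j < N)
    (c \*: ((fun y : E => y ord0 j) * (fun y : E => y ord0 j))).
  apply/funext => y; rewrite /paraboloid /= fct_sumE; congr (_ - _).
  by apply: eq_bigr => j _; rewrite mulrC expr2.
apply: (is_derive_eq D); rewrite sub0r (bigD1 i)//= eqxx big1 ?addr0.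
  by rewrite mulr1 mulrC.
by move=> j /negbTE; rewrite eq_sym => ->; rewrite !mulr0.
Qed.

(** On the support, [|x_i| < n + 1] bounds the derivative of the paraboloid by
    [2 / (n + 1)], while [flat 2 <= 2!]. The decay in [n] is what makes the
    gradient of the cutoff harmless in the limit. *)
Lemma partial_cutoff_le n x i :
  `|'D_(basis_rV i) (cutoff n) x| <= 4 / flat 0 1 / n.+1%:R.
Proof.
have D1 := is_derive_comp1 (is_derive_flat 0 (paraboloid n x))
  (is_derive_paraboloid n x i).
have D2 := is_deriveZ (flat 0 1)^-1 D1.
have -> : cutoff n = (flat 0 1)^-1 \*: (flat 0 \o paraboloid n).
  by apply/funext => y; rewrite /cutoff mulrC.
have [_ ->] := D2; rewrite mul0r subr0 -[_ *: _]/(_ * _).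
have f0 := flat0_gt0.
rewrite normrM gtr0_norm ?invr_gt0// mulrC [leRHS]mulrAC.
rewrite ler_wpM2r ?invr_ge0 ?(ltW f0)//.
have [xn|xn] := leP n.+1%:R `|x ord0 i|.
  have -> : flat 2 (paraboloid n x) = 0.
    by rewrite /flat ltNge (paraboloid_le0 xn).
  by rewrite mul0r normr0 divr_ge0.
rewrite normrM ger0_norm ?flat_ge0// normrN !normrM normfV normrX !normr_nat.
have -> : (4 / n.+1%:R : R) = (2 * (2 * n.+1%:R / n.+1%:R ^+ 2)).
  by move: (pnatr_eq0 R n.+1) => /negbT; move: (n.+1%:R : R) => r r0; field.
apply: ler_pM; rewrite ?flat_ge0//. 
  exact: (flat_le 2).
by rewrite ler_wpM2r ?invr_ge0 ?exprn_ge0// ler_wpM2l// ltW.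
Qed.

End cutoff.

(** * Borel sets and boxes in R^n *)

Section borel_rV.
Context {R : realType} {N : nat}.
Local Notation E := 'rV[R]_N.

Lemma measurable_open_box (c : E) (r : R) :
  measurable [set x : E | forall i, `|x ord0 i - c ord0 i| < r].
Proof.
rewrite [X in measurable X](_ : _ = \bigcap_(i in [set: 'I_N])
    @rV_coord R N i @^-1` [set t | `|t - c ord0 i| < r]); last first.
  by apply/seteqP; split=> x /= h i; [move=> _; exact: h|exact: h].
apply: fin_bigcap_measurable => // i _; rewrite -[X in measurable X]setTI.
apply: measurable_rV_coord => //; apply: open_measurable.
rewrite (_ : [set _ | _] = ball (c ord0 i) r); first exact: ball_open.
by apply/seteqP; split=> t; rewrite /ball /= distrC.
Qed.

(** An open set is the union of the boxes with rational centre and radius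
    [1 / (k + 1)] that it contains, and there are countably many of those. *)
Lemma open_measurable_rV (A : set E) : open A -> measurable A.
Proof.
move=> oA.
pose rat_box (p : 'rV[rat]_N * nat) : set E :=
  [set x | forall i, `|x ord0 i - ratr (p.1 ord0 i)| < p.2.+1%:R^-1].
have mrat_box p : measurable (rat_box p).
  have := measurable_open_box (\row_i ratr (p.1 ord0 i)) p.2.+1%:R^-1.
  by congr measurable; apply/seteqP; split=> x /= h i; have := h i; rewrite mxE.
rewrite [X in measurable X](_ : A = \bigcup_p
    (if `[< rat_box p `<=` A >] then rat_box p else set0)); last first.
  apply/seteqP; split=> [x Ax|x [p _]]; last by case: ifPn => // /asboolP; exact.
  have /nbhs_ballP[e /= e0 xe] : nbhs x A by exact: open_nbhs_nbhs.
  have e2 : 0 < e / 2 by rewrite divr_gt0.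
  have [k _ /(_ k (leqnn k)) /= ke] := near_infty_natSinv_lt (PosNum e2).
  have kp : 0 < (k.+1%:R^-1 : R) by rewrite invr_gt0.
  have hq i : exists q : rat, `|x ord0 i - ratr q| < k.+1%:R^-1.
    have lt : x ord0 i - k.+1%:R^-1 < x ord0 i + k.+1%:R^-1.
      by rewrite ltrD2l gt0_cp.
    have [q] := rat_in_itvoo lt.
    by rewrite in_itv /= => qx; exists q; rewrite distrC ltr_distl.
  have [q qP] := choice hq.
  exists (\row_i q i, k) => //; rewrite ifT.
    by move=> i; rewrite mxE.
  apply/asboolP => y yc; apply: xe; split=> // i0 i; rewrite ord1 /ball /=.
  have := yc i; rewrite /= mxE => yq.
  rewrite (le_lt_trans (ler_distD (ratr (q i)) _ _))// (splitr e) ltrD//.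
    exact: lt_trans (qP i) ke.
  by rewrite distrC; exact: lt_trans yq ke.
apply: countable_bigcupT_measurable; first exact: countableP.
by move=> p; case: ifPn.
Qed.

Lemma continuous_measurable_rV (f : E -> R) :
  continuous f -> measurable_fun [set: E] (f : E -> measurableTypeR R).
Proof.
move=> /continuousP cf; apply: (measurability _ (RGenOpens.measurableE R)).
move=> _ [_ [a [b ->] <-]]; rewrite setTI; apply: open_measurable_rV.
by apply: cf; exact: interval_open.
Qed.

Definition box (r : R) : set E := [set x | forall i, `|x ord0 i| <= r].

Lemma measurable_box r : measurable (box r).
Proof.
rewrite [X in measurable X](_ : _ = \bigcap_(i in [set: 'I_N])
    @rV_coord R N i @^-1` `[- r, r]); last first.
  apply/seteqP; split=> x /= h i => [_|].
    by rewrite /= in_itv /= -ler_norml; exact: h.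
  by have := h i I; rewrite /= in_itv /= -ler_norml.
apply: fin_bigcap_measurable => // i _; rewrite -[X in measurable X]setTI.
by apply: measurable_rV_coord.
Qed.

Lemma box_finite r : (lebesgue_rV N (box r) < +oo)%E.
Proof.
rewrite [X in lebesgue_rV N X](_ : _ =
    [set x : E | forall i, `[- r, r]%classic (x ord0 i)]); last first.
  apply/seteqP; split=> x /= h i; have := h i.
    by rewrite /= in_itv /= -ler_norml.
  by rewrite /= in_itv /= -ler_norml.
rewrite (@lebesgue_rV_box R N (fun _ => `[- r, r]%classic))//.
set p := (\prod_(i < N) _)%E; suff [] : (0 <= p)%E /\ (p < +oo)%E by [].
rewrite /p; elim/big_ind : _ => [|x y [x0 xoo] [y0 yoo]|i _].
- by split; rewrite ?ltry ?lee_fin.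
- by split; [exact: mule_ge0|]; rewrite lte_mul_pinfty// ge0_fin_numE.
split=> //; rewrite lebesgue_measure_itv /=; case: ifPn => _ //.
by rewrite -EFinD ltry.
Qed.

Lemma compact_sub_box (K : set E) : compact K -> exists r : R, K `<=` box r.
Proof.
move=> /compact_bounded[M [_ KM]]; exists (M + 1) => x Kx i.
have := KM (M + 1); rewrite ltrDl ltr01 => /(_ isT x Kx).
apply: le_trans; rewrite -[leRHS]/(mx_norm x) mx_normrE.
exact: (le_bigmax 0 (fun ij : 'I_1 * 'I_N => `|x ij.1 ij.2|) (ord0, i)).
Qed.

End borel_rV.

(** * Complex-valued square-integrable functions *)

Section complex_parts.
Context {R : realType}.
Implicit Types z w : R[i].
Local Notation Re := complex.Re.
Local Notation Im := complex.Im.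

Definition sqnormc z : R := Re z ^+ 2 + Im z ^+ 2.

Lemma ReD z w : Re (z + w) = Re z + Re w. Proof. by case: z w => ? ? []. Qed.
Lemma ImD z w : Im (z + w) = Im z + Im w. Proof. by case: z w => ? ? []. Qed.
Lemma ReN z : Re (- z) = - Re z. Proof. by case: z. Qed.
Lemma ImN z : Im (- z) = - Im z. Proof. by case: z. Qed.
Lemma ReM z w : Re (z * w) = Re z * Re w - Im z * Im w.
Proof. by case: z w => ? ? []. Qed.
Lemma ImM z w : Im (z * w) = Re z * Im w + Im z * Re w.
Proof. by case: z w => ? ? []. Qed.
Lemma ReJ z : Re z^* = Re z. Proof. by case: z. Qed.
Lemma ImJ z : Im z^* = - Im z. Proof. by case: z. Qed.

Lemma Re_sum (I : Type) (s : seq I) (f : I -> R[i]) :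
  Re (\sum_(i <- s) f i) = \sum_(i <- s) Re (f i).
Proof. by elim/big_ind2 : _ => // z ? w ? <- <-; rewrite ReD. Qed.

Definition complex_partE := (ReD, ImD, ReN, ImN, ReM, ImM, ReJ, ImJ).

Lemma eq_ReIm z w : Re z = Re w -> Im z = Im w -> z = w.
Proof. by case: z w => ? ? [? ?] /= -> ->. Qed.

Lemma sqnormc_ge0 z : 0 <= sqnormc z.
Proof. by rewrite addr_ge0 ?sqr_ge0. Qed.

Lemma sqnormcM z w : sqnormc (z * w) = sqnormc z * sqnormc w.
Proof. by rewrite /sqnormc !complex_partE; ring. Qed.

Lemma sqnormcJ z : sqnormc z^* = sqnormc z.
Proof. by rewrite /sqnormc !complex_partE; ring. Qed.

Lemma sqnormc_real (r : R) : sqnormc r%:C = r ^+ 2.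
Proof. by rewrite /sqnormc /= expr0n addr0. Qed.

Lemma normcK z : normc z ^+ 2 = sqnormc z.
Proof. by case: z => x y; rewrite /= sqr_sqrtr// addr_ge0 ?sqr_ge0. Qed.

Lemma normc_ge0 z : 0 <= normc z.
Proof. by case: z => x y; exact: sqrtr_ge0. Qed.

Lemma normcEsqrt z : normc z = Num.sqrt (sqnormc z).
Proof. by case: z. Qed.

Lemma sqnormcD_le z w : sqnormc (z + w) <= 2 * (sqnormc z + sqnormc w).
Proof.
rewrite /sqnormc !complex_partE.
have h1 := sqr_ge0 (Re z - Re w); have h2 := sqr_ge0 (Im z - Im w).
by nra.
Qed.

(** The free parameter [t] trades the two factors against each other: where one
    of them is only known to be small, letting [t] tend to 0 does the work of
    the Cauchy-Schwarz inequality, without taking square roots of integrals. *)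
Lemma young_Re z w (t : R) : 0 < t ->
  `|Re (z * w)| <= t * sqnormc z + t^-1 * sqnormc w.
Proof.
move=> t0; rewrite -(ler_pM2l t0) mulrDr !mulrA divff ?gt_eqF// mul1r.
rewrite -{1}(gtr0_norm t0) -normrM /sqnormc !complex_partE ler_norml.
move: (Re z) (Im z) (Re w) (Im w) => a b c e.
have h1 := sqr_ge0 (t * a - c); have h2 := sqr_ge0 (t * b + e).
have h3 := sqr_ge0 (t * a + c); have h4 := sqr_ge0 (t * b - e).
have h5 := sqr_ge0 (t * a); have h6 := sqr_ge0 (t * b).
have h7 := sqr_ge0 c; have h8 := sqr_ge0 e.
by apply/andP; split; nra.
Qed.

Lemma abs_ReM_le z w : `|Re (z * w)| <= sqnormc z + sqnormc w.
Proof. by have := young_Re z w ltr01; rewrite invr1 !mul1r. Qed.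

Lemma abs_ImM_le z w : `|Im (z * w)| <= sqnormc z + sqnormc w.
Proof.
have := abs_ReM_le z ('i * w); rewrite sqnormcM {2}/sqnormc /=.
rewrite expr0n expr1n add0r mul1r !complex_partE /= -normrN.
by congr (`|_| <= _); ring.
Qed.

End complex_parts.

Section complex_L2.
Context d {T : measurableType d} {R : realType}.
Variables (mu : {measure set T -> \bar R}) (D : set T).
Hypothesis mD : measurable D.
Local Notation Re := complex.Re.
Local Notation Im := complex.Im.
Implicit Types (f g : T -> R[i]) (h k : T -> R).
Local Notation integ h := (mu.-integrable D (EFin \o h)).

Lemma ae_le_Rintegrable h k : measurable_fun D h -> integ k ->
  (\forall x \ae mu, D x -> `|h x| <= k x) -> integ h.
Proof.
move=> mh /integrableP[mk koo] hk; apply/integrableP; split.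
  exact/measurable_EFinP.
apply: le_lt_trans koo; apply: ae_ge0_le_integral => //.
- by apply: measurableT_comp => //; exact/measurable_EFinP.
- exact: measurableT_comp.
- apply: filterS hk => x hk Dx; rewrite /= lee_fin.
  by rewrite (le_trans (hk Dx))// ler_norm.
Qed.

Lemma le_Rintegrable h k : measurable_fun D h -> integ k ->
  (forall x, D x -> `|h x| <= k x) -> integ h.
Proof. by move=> mh ik hk; apply: (ae_le_Rintegrable mh ik); exact: aeW. Qed.

Lemma integrable_measurable h : integ h -> measurable_fun D h.
Proof. by case/integrableP => /measurable_EFinP. Qed.

Lemma integrableRD h k : integ h -> integ k -> integ (fun x => h x + k x).
Proof. exact: integrableD. Qed.

Lemma integrableRB h k : integ h -> integ k -> integ (fun x => h x - k x).
Proof. exact: integrableB. Qed.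

Lemma integrableRZ (r : R) h : integ h -> integ (fun x => r * h x).
Proof. exact: integrableZl. Qed.

Lemma integrableR_sum (I : Type) (s : seq I) (h : I -> T -> R) :
  (forall i, integ (h i)) -> integ (fun x => \sum_(i <- s) h i x).
Proof.
move=> ih; rewrite (_ : EFin \o _ = fun x => \sum_(i <- s) (h i x)%:E)%E.
  by apply: integrable_sum => // i _; exact: ih.
by apply/funext => x; rewrite sumEFin.
Qed.

Lemma Rintegral_sum (I : Type) (s : seq I) (h : I -> T -> R) :
  (forall i, integ (h i)) ->
  \int[mu]_(x in D) (\sum_(i <- s) h i x) = \sum_(i <- s) \int[mu]_(x in D) h i x.
Proof.
move=> ih; elim: s => [|i s IH].
  rewrite big_nil (@eq_Rintegral _ _ _ _ _ (fun _ => 0)).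
    by rewrite Rintegral_cst// mul0r.
  by move=> x _; rewrite big_nil.
rewrite big_cons -IH -RintegralD//; last exact: integrableR_sum.
by apply: eq_Rintegral => x _; rewrite big_cons.
Qed.

Definition cmeasurable f :=
  measurable_fun D (fun x => Re (f x)) /\ measurable_fun D (fun x => Im (f x)).

(** Integrability of the squared modulus, instead of finiteness of a norm: every
    estimate below is a pointwise inequality integrated afterwards. *)
Definition L2 f := cmeasurable f /\ integ (fun x => sqnormc (f x)).

Lemma cmeasurableM f g :
  cmeasurable f -> cmeasurable g -> cmeasurable (fun x => f x * g x).
Proof.
move=> [fr fi] [gr gi]; split.
  rewrite (_ : (fun x => _) =
      fun x => Re (f x) * Re (g x) - Im (f x) * Im (g x)).
    by apply: measurable_funB; exact: measurable_funM.
  by apply/funext => x; rewrite ReM.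
rewrite (_ : (fun x => _) =
    fun x => Re (f x) * Im (g x) + Im (f x) * Re (g x)).
  by apply: measurable_funD; exact: measurable_funM.
by apply/funext => x; rewrite ImM.
Qed.

Lemma cmeasurableD f g :
  cmeasurable f -> cmeasurable g -> cmeasurable (fun x => f x + g x).
Proof.
move=> [fr fi] [gr gi]; split.
  under eq_fun do rewrite ReD; exact: measurable_funD.
under eq_fun do rewrite ImD; exact: measurable_funD.
Qed.

Lemma cmeasurableJ f : cmeasurable f -> cmeasurable (fun x => (f x)^*).
Proof.
move=> [fr fi]; split; first by under eq_fun do rewrite ReJ.
by under eq_fun do rewrite ImJ; exact: measurableT_comp.
Qed.

Lemma cmeasurable_real h : measurable_fun D h -> cmeasurable (fun x => (h x)%:C).
Proof. by move=> mh; split=> //=; exact: measurable_cst. Qed.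

Lemma cmeasurable_cst (z : R[i]) : cmeasurable (fun _ => z).
Proof. by split; exact: measurable_cst. Qed.

Lemma cmeasurable_sqnormc f :
  cmeasurable f -> measurable_fun D (fun x => sqnormc (f x)).
Proof. by case=> fr fi; apply: measurable_funD; exact: measurable_funX. Qed.

Lemma measurable_fun_normc f :
  cmeasurable f -> measurable_fun D (fun x => normc (f x)).
Proof.
move=> mf; under eq_fun do rewrite normcEsqrt.
apply: measurableT_comp; last exact: cmeasurable_sqnormc.
by apply: continuous_measurable_fun; exact: sqrt_continuous.
Qed.

Lemma L2_ae_le f h : cmeasurable f -> integ h ->
  (\forall x \ae mu, D x -> sqnormc (f x) <= h x) -> L2 f.
Proof.
move=> mf ih fh; split=> //; apply: ae_le_Rintegrable ih _.
  exact: cmeasurable_sqnormc.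
by apply: filterS fh => x fh Dx; rewrite ger0_norm ?sqnormc_ge0//; exact: fh.
Qed.

Lemma L2_le f h : cmeasurable f -> integ h ->
  (forall x, D x -> sqnormc (f x) <= h x) -> L2 f.
Proof. by move=> mf ih fh; apply: (L2_ae_le mf ih); exact: aeW. Qed.

Lemma L2D f g : L2 f -> L2 g -> L2 (fun x => f x + g x).
Proof.
move=> [mf fi] [mg gi].
apply: (L2_le (h := fun x => 2 * (sqnormc (f x) + sqnormc (g x)))).
- exact: cmeasurableD.
- by apply: integrableRZ; exact: integrableRD.
- by move=> x _; exact: sqnormcD_le.
Qed.

Lemma L2M f g (C : R) : cmeasurable f -> (forall x, D x -> sqnormc (f x) <= C) ->
  L2 g -> L2 (fun x => f x * g x).
Proof.
move=> mf fC [mg gi]; apply: (L2_le (h := fun x => C * sqnormc (g x))).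
- exact: cmeasurableM.
- exact: integrableRZ.
- by move=> x Dx; rewrite sqnormcM ler_wpM2r ?sqnormc_ge0// fC.
Qed.

Lemma L2J f : L2 f -> L2 (fun x => (f x)^*).
Proof.
move=> [mf fi]; split; first exact: cmeasurableJ.
by under eq_fun do rewrite sqnormcJ.
Qed.

Lemma L2Z (z : R[i]) f : L2 f -> L2 (fun x => z * f x).
Proof. exact/L2M/(fun _ _ => lexx _)/cmeasurable_cst. Qed.

Lemma L2N f : L2 f -> L2 (fun x => - f x).
Proof.
by move/(L2Z (-1)); congr L2; apply/funext => x; rewrite mulN1r.
Qed.

Lemma L2B f g : L2 f -> L2 g -> L2 (fun x => f x - g x).
Proof. by move=> f2 /L2N; exact: L2D. Qed.

Lemma integrable_ReM f g : L2 f -> L2 g -> integ (fun x => Re (f x * g x)).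
Proof.
move=> [mf fi] [mg gi].
apply: (le_Rintegrable (k := fun x => sqnormc (f x) + sqnormc (g x))).
- by case: (cmeasurableM mf mg).
- exact: integrableRD.
- by move=> x _; exact: abs_ReM_le.
Qed.

Lemma integrable_ImM f g : L2 f -> L2 g -> integ (fun x => Im (f x * g x)).
Proof.
move=> [mf fi] [mg gi].
apply: (le_Rintegrable (k := fun x => sqnormc (f x) + sqnormc (g x))).
- by case: (cmeasurableM mf mg).
- exact: integrableRD.
- by move=> x _; exact: abs_ImM_le.
Qed.

End complex_L2.

(** * Smooth complex functions and test functions *)

Section smooth_functions.
Context {R : realType} {N : nat}.
Local Notation E := 'rV[R]_N.
Local Notation C := R[i].
Local Notation mu := (@lebesgue_rV R N).
Local Notation Re := complex.Re.
Local Notation Im := complex.Im.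
Implicit Types (phi psi : E -> C) (i : 'I_N) (x : E).

Definition smooth phi := (forall k, Ck k (fun x => Re (phi x))) /\
  (forall k, Ck k (fun x => Im (phi x))).

Lemma test_function_smooth (Om : set E) phi : test_function Om phi -> smooth phi.
Proof. by case. Qed.

Lemma smoothM phi psi : smooth phi -> smooth psi ->
  smooth (fun x => phi x * psi x).
Proof.
move=> [fr fi] [gr gi]; split=> k.
  apply: (@eq_Ck _ _ _
    (fun x => Re (phi x) * Re (psi x) + - (Im (phi x) * Im (psi x)))).
    by move=> x; rewrite ReM.
  by apply: CkD; [|apply: CkN]; apply: CkM.
apply: (@eq_Ck _ _ _
  (fun x => Re (phi x) * Im (psi x) + Im (phi x) * Re (psi x))).
  by move=> x; rewrite ImM.
by apply: CkD; apply: CkM.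
Qed.

Lemma smoothJ phi : smooth phi -> smooth (fun x => (phi x)^*).
Proof.
move=> [fr fi]; split=> k.
  by apply: eq_Ck (fr k) => x; rewrite ReJ.
by apply: eq_Ck (CkN (fi k)) => x; rewrite ImJ.
Qed.

Lemma smooth_partial i phi : smooth phi -> smooth (partial i phi).
Proof. by move=> [fr fi]; split=> k; exact: Ck_partial. Qed.

Lemma smooth_cst (z : C) : smooth (fun _ : E => z).
Proof. by split=> k; exact: Ck_cst. Qed.

Lemma smooth_real (h : E -> R) : (forall k, Ck k h) -> smooth (fun x => (h x)%:C).
Proof. by move=> hk; split=> // k; exact: Ck_cst. Qed.

Lemma smooth_derivable phi i x : smooth phi ->
  derivable (fun x => Re (phi x)) x (basis_rV i) /\
  derivable (fun x => Im (phi x)) x (basis_rV i).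
Proof.
by case=> fr fi; split; apply: Ck_derivable; [exact: (fr 1%N)|exact: (fi 1%N)].
Qed.

Lemma partialM i phi psi x : smooth phi -> smooth psi ->
  partial i (fun x => phi x * psi x) x =
  phi x * partial i psi x + partial i phi x * psi x.
Proof.
move=> /(@smooth_derivable _ i x)[fr fi] /(@smooth_derivable _ i x)[gr gi].
have [_ DRe] := is_deriveB (is_deriveM (derivableP fr) (derivableP gr))
  (is_deriveM (derivableP fi) (derivableP gi)).
have [_ DIm] := is_deriveD (is_deriveM (derivableP fr) (derivableP gi))
  (is_deriveM (derivableP fi) (derivableP gr)).
apply: eq_ReIm; rewrite !complex_partE /partial /=.
  under eq_fun do rewrite ReM.
  by rewrite [LHS]DRe /GRing.scale /=; ring.
under eq_fun do rewrite ImM.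
by rewrite [LHS]DIm /GRing.scale /=; ring.
Qed.

Lemma partialJ i phi x : smooth phi ->
  partial i (fun x => (phi x)^*) x = (partial i phi x)^*.
Proof.
move=> /(@smooth_derivable _ i x)[fr fi]; apply: eq_ReIm; rewrite !complex_partE /=.
  by congr ('D_ _ _ _); apply/funext => y; rewrite ReJ.
rewrite -deriveN//; congr ('D_ _ _ _).
by apply/funext => y; rewrite ImJ.
Qed.

Lemma partial_real i (h : E -> R) x :
  partial i (fun x => (h x)%:C) x = ('D_(basis_rV i) h x)%:C.
Proof. by apply: eq_ReIm => //=; rewrite derive_cst. Qed.

Lemma partial_cst i (z : C) x : partial i (fun _ => z) x = 0.
Proof. by apply: eq_ReIm => /=; exact: derive_cst. Qed.

Lemma test_functionM (Om : set E) psi phi : smooth psi -> test_function Om phi ->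
  test_function Om (fun x => psi x * phi x).
Proof.
move=> sp tp; have [sr si] := smoothM sp (test_function_smooth tp).
have [_ _ [K [cK KOm K0]]] := tp.
by split=> //; exists K; split=> // x /K0 ->; rewrite mulr0.
Qed.

Lemma test_functionJ (Om : set E) phi : test_function Om phi ->
  test_function Om (fun x => (phi x)^*).
Proof.
move=> tp; have [sr si] := smoothJ (test_function_smooth tp).
have [_ _ [K [cK KOm K0]]] := tp.
by split=> //; exists K; split=> // x /K0 ->; rewrite conjc0.
Qed.

(** The complement of the support is open, so that the derivative vanishes
    there too. *)
Lemma test_function_partial (Om : set E) i phi : test_function Om phi ->
  test_function Om (partial i phi).
Proof.
move=> tp; have [sr si] := smooth_partial i (test_function_smooth tp).
have [_ _ [K [cK KOm K0]]] := tp.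
split=> //; exists K; split=> // x Kx.
have nK : \forall y \near x, phi y = 0.
  have oK : open (~` K) by apply: closed_openC; exact: compact_closed.
  have xK : nbhs x (~` K) by exact: open_nbhs_nbhs.
  by apply: filterS xK; exact: K0.
have dRe : 'D_(basis_rV i) (fun y => Re (phi y)) x = 'D_(basis_rV i) (cst 0) x.
  by apply: near_eq_derive; apply: filterS nK => y ->.
have dIm : 'D_(basis_rV i) (fun y => Im (phi y)) x = 'D_(basis_rV i) (cst 0) x.
  by apply: near_eq_derive; apply: filterS nK => y ->.
by rewrite /partial dRe dIm derive_cst.
Qed.

Lemma smooth_cmeasurable (D : set E) phi : measurable D -> smooth phi ->
  cmeasurable D phi.
Proof.
by move=> mD [fr fi]; split; apply: measurable_funTS;
  apply: continuous_measurable_rV;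
  [exact: Ck_continuous (fr 0%N)|exact: Ck_continuous (fi 0%N)].
Qed.

Lemma integrable_box (D : set E) r : measurable D ->
  mu.-integrable D (EFin \o (\1_(box r) : E -> R)).
Proof.
move=> mD; have mc := @measurable_box R N r; apply/integrableP; split.
  by apply/measurable_EFinP; exact: measurable_indic.
rewrite (eq_integral (fun x => (\1_(box r) x)%:E)); last first.
  by move=> x _ /=; rewrite ger0_norm.
rewrite integral_indic//; apply: le_lt_trans (box_finite r).
by apply: le_measure; rewrite ?inE//; exact: measurableI.
Qed.

Lemma continuous_compact_bounded (h : E -> R) (K : set E) :
  continuous h -> compact K -> exists M : R, forall x, K x -> `|h x| <= M.
Proof.
move=> ch cK; have /compact_bounded[M [_ hM]] : compact (h @` K).
  by apply: continuous_compact => //; exact: continuous_subspaceT.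
exists (M + 1) => x Kx; apply: (hM (M + 1)); first by rewrite ltrDl.
by exists x.
Qed.

Lemma test_function_L2 (Om : set E) phi : open Om -> test_function Om phi ->
  L2 mu Om phi.
Proof.
move=> oOm tp; have mOm := open_measurable_rV oOm.
have [fr fi [K [cK _ K0]]] := tp.
have [M1 hM1] := continuous_compact_bounded (Ck_continuous (fr 0%N)) cK.
have [M2 hM2] := continuous_compact_bounded (Ck_continuous (fi 0%N)) cK.
have [r Kr] := compact_sub_box cK.
apply: (L2_le mOm (h := fun x => (M1 ^+ 2 + M2 ^+ 2) * \1_(box r) x)).
- exact/smooth_cmeasurable/test_function_smooth/tp.
- by apply: integrableRZ => //; exact: integrable_box.
move=> x _; have [Kx|nKx] := pselect (K x); last first.
  rewrite (K0 x nKx) /sqnormc /= expr0n addr0 mulr_ge0// addr_ge0 ?sqr_ge0//.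
rewrite indicE mem_set ?mulr1; last exact: Kr.
rewrite /sqnormc -[Re _ ^+ 2]real_normK ?num_real//.
rewrite -[Im _ ^+ 2]real_normK ?num_real//.
by apply: lerD; rewrite lerXn2r ?nnegrE ?(le_trans _ (hM1 _ Kx))
  ?(le_trans _ (hM2 _ Kx)).
Qed.

End smooth_functions.

(** * Norms as integrals *)

Section norms.
Context {R : realType} {N : nat}.
Local Notation E := 'rV[R]_N.
Local Notation C := R[i].
Local Notation mu := (@lebesgue_rV R N).
Local Notation Re := complex.Re.
Local Notation Im := complex.Im.
Variables (Om : set E).
Hypothesis mOm : measurable Om.
Implicit Types (f : E -> C).

Lemma poweR2 (x : \bar R) : (0 <= x -> x `^ 2 = x ^+ 2)%E.
Proof.
case: x => [r|_|//]; last by rewrite poweRyr// expe2 mulyy.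
by rewrite lee_fin => r0; rewrite poweR_EFin powR_mulrn.
Qed.

Lemma powR_normL (p : R) f : p != 0 ->
  (normL Om p%:E f `^ p = \int[mu]_(x in Om) (normc (f x) `^ p)%:E)%E.
Proof.
move=> p0; rewrite /normL poweR_Lnorm// [RHS]integral_mkcond.
apply: eq_integral => x _; rewrite /= !patchE; case: ifPn => _.
  by rewrite ger0_norm ?normc_ge0.
by rewrite [X in `|X|](_ : _ = 0 :> R)// normr0 powR0.
Qed.

Lemma sqr_normL2 f :
  (normL Om 2%:E f ^+ 2 = \int[mu]_(x in Om) (sqnormc (f x))%:E)%E.
Proof.
rewrite -poweR2 ?Lnorm_ge0// powR_normL//.
by apply: eq_integral => x _; rewrite powR_mulrn ?normc_ge0// normcK.
Qed.

Lemma memL2P f : memL Om 2%:E f <-> L2 mu Om f.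
Proof.
have oo : (normL Om 2%:E f < +oo)%E <->
    (\int[mu]_(x in Om) (sqnormc (f x))%:E < +oo)%E.
  rewrite -sqr_normL2 expe2.
  have := Lnorm_ge0 mu 2%:E (EFin \o ((fun x => normc (f x)) \_ Om)).
  rewrite -/(normL Om 2%:E f); case: (normL Om 2%:E f) => [r|_|//].
    by move=> _; rewrite -EFinM !ltry.
  by rewrite mulyy.
have E1 : (\int[mu]_(x in Om) `|(sqnormc (f x))%:E| =
    \int[mu]_(x in Om) (sqnormc (f x))%:E)%E.
  by apply: eq_integral => x _; rewrite gee0_abs// lee_fin sqnormc_ge0.
split=> [[mr mi foo]|[[mr mi] /integrableP[_]]].
  split=> //; apply/integrableP; split; last by rewrite E1; exact/oo.
  by apply/measurable_EFinP; exact: cmeasurable_sqnormc.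
by rewrite E1 => /oo ?; split.
Qed.

(** On square-integrable functions the sum of squared norms is finite, hence a
    single real integral. *)
Lemma sqnormH1E f (Df : 'I_N -> E -> C) :
  L2 mu Om f -> (forall i, L2 mu Om (Df i)) ->
  sqnormH1 Om f Df =
  (\int[mu]_(x in Om) (sqnormc (f x) + \sum_i sqnormc (Df i x)))%:E.
Proof.
move=> f2 Df2; rewrite /sqnormH1 sqr_normL2.
under [X in (_ + X)%E]eq_bigr do rewrite sqr_normL2.
have int g : L2 mu Om g -> mu.-integrable Om (EFin \o (fun x => sqnormc (g x))).
  by case.
rewrite RintegralD//; last 2 first.
- exact: int.
- by apply: integrableR_sum => // i; exact: int.
rewrite Rintegral_sum// ?EFinD -?sumEFin; last by move=> i; exact: int.
congr (_ + _)%E; first by rewrite fineK// integrable_fin_num//; exact: int.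
by apply: eq_bigr => i _; rewrite fineK// integrable_fin_num//; exact: int.
Qed.

Lemma lebesgue_rV_setT_gt0 : (0 < mu [set: E])%E.
Proof.
have -> : [set: E] = [set x | forall i, [set: measurableTypeR R] (x ord0 i)].
  by apply/seteqP; split.
rewrite (@lebesgue_rV_box R N (fun _ => setT))//.
elim/big_ind : _ => // [x y x0 y0|i _]; first exact: mule_gt0.
by rewrite -set_itvNyy lebesgue_measure_itv /= addye// ltry.
Qed.

(** The measure of the whole space has to be positive for the essential supremum
    not to be replaced by 0 in the norm; for the sake of the equation the bound
    is put on the square of [V]. *)
Lemma memL_pinfty (V : E -> R) : memL Om +oo%E (fun x => (V x)%:C) ->
  exists K : R, [/\ 0 <= K, normL Om +oo%E (fun x => (V x)%:C) = K%:E,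
    measurable_fun Om V & \forall x \ae mu, Om x -> (V x) ^+ 2 <= K ^+ 2].
Proof.
move=> [mV _ Voo]; set nV := normL _ _ _ in Voo *.
have nV0 : (0 <= nV)%E by exact: Lnorm_ge0.
have nVf : nV \is a fin_num by rewrite ge0_fin_numE.
exists (fine nV); split; [exact: fine_ge0|by rewrite fineK|by []|].
have nVE : nV = ess_sup mu
    (abse \o (EFin \o ((fun x => normc (V x)%:C) \_ Om))).
  by rewrite /nV /normL unlock lebesgue_rV_setT_gt0.
have := ess_sup_ge mu (abse \o (EFin \o ((fun x => normc (V x)%:C) \_ Om))).
rewrite -nVE; apply: filterS => x + Omx.
rewrite /= patchE mem_set// expr0n addr0 sqrtr_sqr normr_id.
rewrite -{1}(fineK nVf) lee_fin => Vn.
by rewrite -(real_normK (num_real (V x))) lerXn2r ?nnegrE ?(le_trans _ Vn).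
Qed.

End norms.

(** * The localized energy density *)

Section powers.
Context {R : realType}.

Lemma powR_mul_sqr (n m : R) : 0 <= n -> 0 < m ->
  n `^ (- (1 - m)) * n ^+ 2 = n `^ (m + 1).
Proof.
move=> n0 m0; have [->|nn0] := eqVneq n 0.
  by rewrite expr0n mulr0 powR0// gt_eqF// ltr_wpDr.
rewrite -powR_mulrn// -powRD ?nn0 ?implybT//.
by congr (_ `^ _); ring.
Qed.

(** Since [m < 1], the singular term [n^m] grows at most linearly. *)
Lemma powR_mul_le (n m : R) : 0 <= n -> 0 < m < 1 ->
  n `^ (- (1 - m)) * n <= 1 + n.
Proof.
move=> n0 /andP[m0 m1]; have [->|nn0] := eqVneq n 0.
  by rewrite mulr0 addr0.
rewrite -{2}(powRr1 n0) -powRD ?nn0 ?implybT//.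
have -> : - (1 - m) + 1 = m by ring.
have n1 : 1 <= 1 + n by rewrite lerDl.
apply: (@le_trans _ _ ((1 + n) `^ m)).
  by apply: ge0_ler_powR; rewrite ?nnegrE ?(ltW m0)// ?lerDr ?addr_ge0.
by rewrite -[leRHS]powRr1 ?addr_ge0// ler_powR// ltW.
Qed.

End powers.

Section localized_energy.
Context {R : realType} {N : nat}.
Local Notation E := 'rV[R]_N.
Local Notation C := R[i].
Local Notation mu := (@lebesgue_rV R N).
Local Notation Re := complex.Re.
Local Notation Im := complex.Im.
Variables (Om : set E) (V : E -> R) (m : R) (a b c : C).
Variables (F u : E -> C) (Du : 'I_N -> E -> C).
Hypothesis oOm : open Om.
Variable K : R.
Hypothesis mV : measurable_fun Om V.
Hypothesis VK : \forall x \ae mu, Om x -> V x ^+ 2 <= K ^+ 2.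
Hypothesis m01 : 0 < m < 1.
Hypothesis F2 : L2 mu Om F.
Hypothesis u2 : L2 mu Om u.
Hypothesis Du2 : forall i, L2 mu Om (Du i).
Variables (psi : E -> C) (B r : R).
Hypothesis B0 : 0 <= B.
Hypothesis psi_smooth : smooth psi.
Hypothesis psiB : forall x, sqnormc (psi x) <= B * \1_(box r) x.
Hypothesis dpsiB : forall i x, sqnormc (partial i psi x) <= B.
Local Notation fu := (nonlinearity V m a b c u).
Local Notation integ h := (mu.-integrable Om (EFin \o h)).

Let mOm : measurable Om. Proof. exact: open_measurable_rV. Qed.

Let mpsi : cmeasurable Om psi. Proof. exact: smooth_cmeasurable. Qed.

Let psi_le x : sqnormc (psi x) <= B.
Proof.
by rewrite (le_trans (psiB x))// -[leRHS]mulr1 ler_wpM2l// indicE lern1 leq_b1.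
Qed.

(** The power term has size [|u|^m <= 1 + |u|]. The constant 1 is not square
    integrable on an unbounded set, which is why the weight [psi] is required
    to be dominated by the indicator of a box. *)
Lemma nonlinearity_L2 : L2 mu Om (fun x => psi x * fu x).
Proof.
have [[mur mui] iu] := u2; have mu1 := proj1 u2.
pose t1 x := (normc (u x) `^ (- (1 - m)))%:C * u x.
have mt1 : cmeasurable Om t1.
  apply: cmeasurableM => //; apply: cmeasurable_real.
  apply: (measurableT_comp (measurable_powR (- (1 - m)))).
  exact: measurable_fun_normc.
have L1 : L2 mu Om (fun x => psi x * t1 x).
  apply: (L2_le mOm (h := fun x => B * (2 * \1_(box r) x + 2 * sqnormc (u x)))).
  - exact: cmeasurableM.
  - apply: integrableRZ => //; apply: integrableRD => //.
      by apply: integrableRZ => //; exact: integrable_box.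
    exact: integrableRZ.
  move=> x _; rewrite sqnormcM.
  have t1x : sqnormc (t1 x) <= 2 + 2 * sqnormc (u x).
    rewrite sqnormcM sqnormc_real -normcK -exprMn.
    have n0 := normc_ge0 (u x); set n := normc (u x) in n0 *.
    have := powR_mul_le n0 m01; set q := _ * n => qn.
    have q0 : 0 <= q by rewrite mulr_ge0 ?powR_ge0.
    apply: (@le_trans _ _ ((1 + n) ^+ 2)); last by have := sqr_ge0 (1 - n); nra.
    by rewrite lerXn2r ?nnegrE ?addr_ge0.
  have := psiB x; rewrite indicE; case: (_ \in _) => /=; rewrite ?mulr1 ?mulr0.
    move=> p; apply: (@le_trans _ _ (B * sqnormc (t1 x))).
      by rewrite ler_wpM2r ?sqnormc_ge0.
    by rewrite ler_wpM2l.
  move=> p0; have -> : sqnormc (psi x) = 0.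
    by apply/eqP; rewrite eq_le p0 sqnormc_ge0.
  by rewrite mul0r add0r !mulr_ge0 ?sqnormc_ge0.
have L2' : L2 mu Om (fun x => psi x * u x) by exact: (L2M _ (C := B)).
pose t3 x := ((V x) ^+ 2)%:C * u x.
have L3 : L2 mu Om (fun x => psi x * t3 x).
  apply: (L2_ae_le mOm (h := fun x => B * (K ^+ 2) ^+ 2 * sqnormc (u x))).
  - apply: cmeasurableM => //; apply: cmeasurableM => //; apply: cmeasurable_real.
    exact: measurable_funX.
  - exact: integrableRZ.
  apply: filterS VK => x /[apply] Vx; rewrite !sqnormcM sqnormc_real mulrA.
  rewrite ler_wpM2r ?sqnormc_ge0// ler_pM ?sqnormc_ge0 ?sqr_ge0//.
  by rewrite lerXn2r ?nnegrE ?sqr_ge0.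
have := L2D mOm (L2D mOm (L2Z mOm a L1) (L2Z mOm b L2')) (L2Z mOm c L3).
congr (L2 _ _ _); apply/funext => x; rewrite /nonlinearity /t1 /t3; ring.
Qed.

Let G x := psi x * (fu x - F x).

Let G2 : L2 mu Om G.
Proof.
have := L2B mOm nonlinearity_L2 (L2M mOm mpsi (fun x _ => psi_le x) F2).
by congr (L2 _ _ _); apply/funext => x; rewrite /G mulrBr.
Qed.

Let psiDu2 i : L2 mu Om (fun x => psi x * Du i x).
Proof. exact: (L2M mOm mpsi (fun x _ => psi_le x)). Qed.

Let dpsiDu2 i : L2 mu Om (fun x => partial i psi x * Du i x).
Proof.
apply: (L2M mOm _ (fun x _ => dpsiB i x)) => //.
by apply: smooth_cmeasurable => //; exact: smooth_partial.
Qed.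

(** The real part of the weak formulation, before integration, for the test
    function [psi * conj v]; [Dv] stands for the gradient of [v], so that the
    sum is the pairing of [Du] with the gradient of this product. *)
Definition energy (v : E -> C) (Dv : 'I_N -> E -> C) (x : E) : R :=
  Re (\sum_i (psi x * Du i x * (Dv i x)^* + partial i psi x * Du i x * (v x)^*)
      + psi x * (fu x - F x) * (v x)^*).

Lemma energyE v Dv x : energy v Dv x =
  \sum_i (Re (psi x * Du i x * (Dv i x)^*)
          + Re (partial i psi x * Du i x * (v x)^*)) + Re (G x * (v x)^*).
Proof.
by rewrite /energy ReD Re_sum; congr (_ + _); apply: eq_bigr => i _; rewrite ReD.
Qed.

Lemma integrable_energy v Dv : L2 mu Om v -> (forall i, L2 mu Om (Dv i)) ->
  integ (energy v Dv).
Proof.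
move=> v2 Dv2; rewrite (funext (energyE v Dv)).
apply: integrableRD => //; last exact/integrable_ReM/L2J.
apply: integrableR_sum => // i; apply: integrableRD => //.
  exact/integrable_ReM/L2J.
exact/integrable_ReM/L2J.
Qed.

Lemma energyB v Dv w Dw x : energy v Dv x - energy w Dw x =
  energy (fun y => v y - w y) (fun i y => Dv i y - Dw i y) x.
Proof.
rewrite !energyE opprD addrACA -sumrB; congr (_ + _); last first.
  by rewrite !complex_partE; ring.
by apply: eq_bigr => i _; rewrite !complex_partE; ring.
Qed.

(** The factor of [t] does not involve [v]: if [v] has squared H^1 norm [t^2],
    the integral of the right-hand side is of order [t]. *)
Lemma energy_young v Dv x (t : R) : 0 < t -> `|energy v Dv x| <=
  t * (\sum_i (sqnormc (psi x * Du i x) + sqnormc (partial i psi x * Du i x))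
       + sqnormc (G x))
  + t^-1 * (N.+1%:R * (sqnormc (v x) + \sum_i sqnormc (Dv i x))).
Proof.
move=> t0; rewrite energyE.
have tV0 : 0 <= t^-1 by rewrite invr_ge0 ltW.
pose A := \sum_i (sqnormc (psi x * Du i x) + sqnormc (partial i psi x * Du i x)).
pose D := \sum_i (sqnormc (Dv i x) + sqnormc (v x)).
have H : `|\sum_i (Re (psi x * Du i x * (Dv i x)^*)
    + Re (partial i psi x * Du i x * (v x)^*))| <= t * A + t^-1 * D.
  rewrite /A /D !mulr_sumr -big_split /=.
  apply: le_trans (ler_norm_sum _ _ _) _; apply: ler_sum => i _.
  apply: le_trans (ler_normD _ _) _.
  have := lerD (young_Re (psi x * Du i x) (Dv i x)^* t0)
    (young_Re (partial i psi x * Du i x) (v x)^* t0).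
  by rewrite !sqnormcJ; move/le_trans; apply; rewrite !mulrDr; lra.
apply: le_trans (ler_normD _ _) _.
apply: le_trans (lerD H (young_Re _ _ t0)) _; rewrite sqnormcJ.
have -> : t * A + t^-1 * D + (t * sqnormc (G x) + t^-1 * sqnormc (v x)) =
  t * (A + sqnormc (G x)) + t^-1 * (D + sqnormc (v x)) by ring.
rewrite lerD2l ler_wpM2l// /D big_split /= sumr_const card_ord.
rewrite -addrA -mulrSr addrC mulrDr mulr_natl lerD2l ler_peMl//.
  by rewrite sumr_ge0// => i _; exact: sqnormc_ge0.
by rewrite ler1n.
Qed.

End localized_energy.

(** * Vanishing of the localized energy *)

Section conjugation.
Context {R : realType}.
Implicit Types z w : R[i].

Lemma conjM z w : (z^* * w)^* = z * w^*.
Proof. by apply: eq_ReIm; rewrite !complex_partE; ring. Qed.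

Lemma conjMD z w z' w' : (z^* * w + z'^* * w')^* = z * w^* + z' * w'^*.
Proof. by apply: eq_ReIm; rewrite !complex_partE; ring. Qed.

End conjugation.

Section complex_integral.
Context {R : realType} {N : nat}.
Local Notation E := 'rV[R]_N.
Local Notation C := R[i].
Local Notation mu := (@lebesgue_rV R N).
Local Notation Re := complex.Re.
Local Notation Im := complex.Im.
Variable Om : set E.
Hypothesis mOm : measurable Om.
Implicit Types f g h k : E -> C.

Lemma CintegralD_mul f g h k : L2 mu Om f -> L2 mu Om g -> L2 mu Om h ->
  L2 mu Om k ->
  Cintegral Om (fun x => f x * g x + h x * k x) =
  Cintegral Om (fun x => f x * g x) + Cintegral Om (fun x => h x * k x).
Proof.
move=> f2 g2 h2 k2; apply: eq_ReIm; rewrite !complex_partE /Cintegral /=.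
  rewrite -RintegralD//; try exact: integrable_ReM.
  by apply: eq_Rintegral => x _; rewrite ReD.
rewrite -RintegralD//; try exact: integrable_ImM.
by apply: eq_Rintegral => x _; rewrite ImD.
Qed.

Lemma eq_Cintegral f g : f =1 g -> Cintegral Om f = Cintegral Om g.
Proof. by move=> /funext ->. Qed.

(** The factor [psi] is moved onto the test function, where the product rule is
    the classical one. *)
Lemma weak_partialM (oOm : open Om) (B : R) psi u (g : E -> C) i :
  smooth psi -> (forall x, sqnormc (psi x) <= B) ->
  (forall x, sqnormc (partial i psi x) <= B) ->
  L2 mu Om u -> L2 mu Om g -> weak_partial Om i u g ->
  weak_partial Om i (fun x => psi x * u x)
    (fun x => psi x * g x + partial i psi x * u x).
Proof.
move=> spsi psiB dpsiB u2 g2 ug phi tphi.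
have tpp := test_functionM spsi tphi.
have sphi := test_function_smooth tphi.
have phi2 := test_function_L2 oOm tphi.
have dphi2 := test_function_L2 oOm (test_function_partial i tphi).
have mpsi := smooth_cmeasurable mOm spsi.
have mdpsi := smooth_cmeasurable mOm (smooth_partial i spsi).
have psiu2 := L2M mOm mpsi (fun x _ => psiB x) u2.
have dpsiu2 := L2M mOm mdpsi (fun x _ => dpsiB x) u2.
have psig2 := L2M mOm mpsi (fun x _ => psiB x) g2.
have := ug _ tpp.
rewrite (@eq_Cintegral (fun x => u x * partial i (fun y => psi y * phi y) x)
  (fun x => (psi x * u x) * partial i phi x + (partial i psi x * u x) * phi x)).
  rewrite CintegralD_mul// => H.
  rewrite (@eq_Cintegral (fun x => (psi x * g x + partial i psi x * u x) * phi x)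
    (fun x => (psi x * g x) * phi x + (partial i psi x * u x) * phi x)); last first.
    by move=> x; rewrite mulrDl.
  rewrite CintegralD_mul// opprD; apply/eqP; rewrite -subr_eq opprK H.
  by apply/eqP; congr (- _); apply: eq_Cintegral => x; ring.
by move=> x; rewrite partialM//; ring.
Qed.

End complex_integral.

Section energy_identity.
Context {R : realType} {N : nat}.
Local Notation E := 'rV[R]_N.
Local Notation C := R[i].
Local Notation mu := (@lebesgue_rV R N).
Local Notation Re := complex.Re.
Local Notation Im := complex.Im.
Variables (Om : set E) (V : E -> R) (m : R) (a b c : C).
Variables (F u : E -> C) (Du : 'I_N -> E -> C).
Hypothesis oOm : open Om.
Variable K : R.
Hypothesis mV : measurable_fun Om V.
Hypothesis VK : \forall x \ae mu, Om x -> V x ^+ 2 <= K ^+ 2.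
Hypothesis m01 : 0 < m < 1.
Hypothesis F2 : L2 mu Om F.
Hypothesis uH1 : H1 Om u Du.
Variables (psi : E -> C) (B r : R).
Hypothesis B0 : 0 <= B.
Hypothesis psi_smooth : smooth psi.
Hypothesis psiB : forall x, sqnormc (psi x) <= B * \1_(box r) x.
Hypothesis dpsiB : forall i x, sqnormc (partial i psi x) <= B.
Local Notation fu := (nonlinearity V m a b c u).
Local Notation energy := (energy V m a b c F u Du psi).
Local Notation integ h := (mu.-integrable Om (EFin \o h)).

Let mOm : measurable Om. Proof. exact: open_measurable_rV. Qed.
Let u2 : L2 mu Om u. Proof. by apply/memL2P => //; case: uH1. Qed.
Let Du2 i : L2 mu Om (Du i).
Proof. by apply/memL2P => //; case: uH1 => _ /(_ i)[]. Qed.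
Let psi_le x : sqnormc (psi x) <= B.
Proof.
by rewrite (le_trans (psiB x))// -[leRHS]mulr1 ler_wpM2l// indicE lern1 leq_b1.
Qed.
Let mpsi : cmeasurable Om psi. Proof. exact: smooth_cmeasurable. Qed.
Let fpsi2 : L2 mu Om (fun x => psi x * fu x).
Proof. exact: (nonlinearity_L2 _ _ _ _ _ VK _ _ _ psi_smooth psiB). Qed.
Let Fpsi2 : L2 mu Om (fun x => psi x * F x).
Proof. exact: (L2M mOm mpsi (fun x _ => psi_le x)). Qed.
Let psiDu2 i : L2 mu Om (fun x => psi x * Du i x).
Proof. exact: (L2M mOm mpsi (fun x _ => psi_le x)). Qed.
Let dpsiDu2 i : L2 mu Om (fun x => partial i psi x * Du i x).
Proof.
apply: (L2M mOm _ (fun x _ => dpsiB i x)) => //.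
by apply: smooth_cmeasurable => //; exact: smooth_partial.
Qed.

Lemma integrable_energy_H1 v Dv : L2 mu Om v -> (forall i, L2 mu Om (Dv i)) ->
  integ (energy v Dv).
Proof.
exact: (integrable_energy _ _ _ oOm mV VK m01 F2 u2 Du2 B0 psi_smooth psiB dpsiB).
Qed.

(** The shape in which the weak formulations provide the energy. Integrals of
    sums may be split because the weight makes each term integrable on its
    own, which may fail for the power term without a weight. *)
Lemma Rintegral_energy v Dv : L2 mu Om v -> (forall i, L2 mu Om (Dv i)) ->
  \int[mu]_(x in Om) energy v Dv x =
  \sum_i \int[mu]_(x in Om)
    Re (Du i x * (psi x * (Dv i x)^* + partial i psi x * (v x)^*))
  + \int[mu]_(x in Om) Re (fu x * (psi x * (v x)^*))
  - \int[mu]_(x in Om) Re (F x * (psi x * (v x)^*)).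
Proof.
move=> v2 Dv2.
have I1 i : integ (fun x =>
    Re (Du i x * (psi x * (Dv i x)^* + partial i psi x * (v x)^*))).
  rewrite (_ : (fun x => _) = fun x => Re (psi x * Du i x * (Dv i x)^*)
      + Re (partial i psi x * Du i x * (v x)^*)).
    by apply: integrableRD => //; exact/integrable_ReM/L2J.
  by apply/funext => x; rewrite -ReD; congr Re; ring.
have I2 : integ (fun x => Re (fu x * (psi x * (v x)^*))).
  rewrite (_ : (fun x => _) = fun x => Re (psi x * fu x * (v x)^*)).
    exact/integrable_ReM/L2J.
  by apply/funext => x; congr Re; ring.
have I3 : integ (fun x => Re (F x * (psi x * (v x)^*))).
  rewrite (_ : (fun x => _) = fun x => Re (psi x * F x * (v x)^*)).
    exact/integrable_ReM/L2J.
  by apply/funext => x; congr Re; ring.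
rewrite -Rintegral_sum// -RintegralD//; last exact: integrableR_sum.
rewrite -RintegralB//; last by apply: integrableRD => //; exact: integrableR_sum.
apply: eq_Rintegral => x _; rewrite energyE -[RHS]addrA; congr (_ + _).
  by apply: eq_bigr => i _; rewrite -ReD; congr Re; ring.
by rewrite -ReN -ReD; congr Re; ring.
Qed.

(** The product [psi * conj phi] is a test function and so are its partial
    derivatives; the weak gradient of [u], tested against the latter, turns the
    distributional Laplacian into the pairing of gradients. *)
Lemma test_energy_eq0 phi : distributional_solution Om V m a b c u F ->
  test_function Om phi ->
  \int[mu]_(x in Om) energy phi (fun i => partial i phi) x = 0.
Proof.
move=> sol tphi.
have tz := test_functionM psi_smooth (test_functionJ tphi).
set z := (fun x => _) in tz.
have dz i x : partial i z x =
    psi x * (partial i phi x)^* + partial i psi x * (phi x)^*.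
  rewrite partialM//; last exact/smoothJ/test_function_smooth/tphi.
  by rewrite partialJ//; exact: test_function_smooth tphi.
have L2t := test_function_L2 oOm.
rewrite Rintegral_energy//; last 2 first.
- exact: L2t.
- by move=> i; exact/L2t/test_function_partial.
have /(congr1 (@complex.Re R)) := sol z tz.
rewrite !complex_partE {1}/Cintegral /= => sol_z.
have lap : \int[mu]_(x in Om) Re (u x * laplacian z x) =
    - \sum_i \int[mu]_(x in Om) Re (Du i x * partial i z x).
  rewrite -sumrN (@eq_Rintegral _ _ _ _ _
    (fun x => \sum_i Re (u x * partial i (partial i z) x))); last first.
    by move=> x _; rewrite /laplacian mulr_sumr Re_sum.
  rewrite Rintegral_sum//; last first.
    move=> i; apply: integrable_ReM => //.
    exact/L2t/test_function_partial/test_function_partial.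
  apply: eq_bigr => i _; case: uH1 => _ /(_ i)[_ wp].
  have /(congr1 (@complex.Re R)) := wp _ (test_function_partial i tz).
  by rewrite complex_partE.
move: sol_z; rewrite lap opprK => <-.
rewrite -[RHS](subrr (\sum_i \int[mu]_(x in Om) Re (Du i x * partial i z x)
   + \int[mu]_(x in Om) Re (fu x * z x))).
congr (_ + _ - _); apply: eq_bigr => i _.
by apply: eq_Rintegral => x _; rewrite dz.
Qed.

(** Test functions [phi] converging to [u] in H^1 have zero energy, and the
    energy is additive in [phi]. Its continuity comes from the weight: against
    [psi] times the nonlinearity, L^2 convergence is enough, whereas the
    approximation gives no control in L^(m+1) on an unbounded domain. *)
Lemma dirichlet_energy_eq0 : distributional_solution Om V m a b c u F ->
  H10 Om u Du -> \int[mu]_(x in Om) energy u Du x = 0.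
Proof.
move=> sol [_ approx].
pose A x := \sum_i (sqnormc (psi x * Du i x) + sqnormc (partial i psi x * Du i x))
       + sqnormc (psi x * (fu x - F x)).
have iA : integ A.
  apply: integrableRD => //.
    apply: integrableR_sum => // i; apply: integrableRD => //.
      by case: (psiDu2 i).
    by case: (dpsiDu2 i).
  rewrite (_ : (fun x => _) = fun x => sqnormc (psi x * fu x - psi x * F x)).
    by case: (L2B mOm fpsi2 Fpsi2).
  by apply/funext => x; rewrite mulrBr.
have small (t : R) : 0 < t -> `|\int[mu]_(x in Om) energy u Du x| <=
    t * (\int[mu]_(x in Om) A x + N.+1%:R).
  (* An error t^2 in squared norm balances the factor t^-1 of energy_young. *)
  move=> t0; have [phi [tphi]] := approx (t ^+ 2) (exprn_gt0 _ t0).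
  have L2t := test_function_L2 oOm.
  have phi2 := L2t _ tphi.
  have dphi2 i := L2t _ (test_function_partial i tphi).
  have d2 : L2 mu Om (fun x => u x - phi x) by exact: L2B.
  have Dd2 i : L2 mu Om (fun x => Du i x - partial i phi x) by exact: L2B.
  rewrite sqnormH1E// lte_fin.
  set Q := (fun x => sqnormc _ + _) => Qt.
  have iQ : integ Q.
    apply: integrableRD => //; first by case: d2.
    by apply: integrableR_sum => // i; case: (Dd2 i).
  rewrite -[\int[_]_(x in _) _]subr0 -(test_energy_eq0 sol tphi).
  rewrite -RintegralB//; last 2 first.
  - exact: integrable_energy_H1.
  - exact: integrable_energy_H1.
  rewrite (eq_Rintegral _ _ (g := energy (fun y => u y - phi y)
     (fun i y => Du i y - partial i phi y))); last first.
    by move=> x _; rewrite energyB.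
  apply: le_trans (le_normr_Rintegral mOm _) _; first exact: integrable_energy_H1.
  apply: (@le_trans _ _ (\int[mu]_(x in Om) (t * A x + t^-1 * (N.+1%:R * Q x)))).
    apply: le_Rintegral => //.
    - exact/integrable_norm/integrable_energy_H1.
    - by apply: integrableRD => //; do ?apply: integrableRZ.
    - by move=> x _; exact: energy_young.
  rewrite RintegralD//; [|exact: integrableRZ|by do ?apply: integrableRZ].
  rewrite !RintegralZl//; last exact: integrableRZ.
  rewrite mulrDr lerD2l ler_pdivrMl// mulrA -expr2 [leRHS]mulrC.
  by rewrite ler_wpM2l// ltW.
apply/eqP; rewrite -normr_eq0; apply/eqP/le_anti; rewrite normr_ge0 andbT.
set S := \int[mu]_(x in Om) A x + N.+1%:R in small.
have S0 : 0 <= S by have := le_trans (normr_ge0 _) (small 1 ltr01); rewrite mul1r.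
apply/ler_addgt0Pl => e e0; rewrite addr0.
have S1 : 0 < S + 1 by rewrite ltr_wpDl.
apply: le_trans (small (e / (S + 1)) (divr_gt0 e0 S1)) _.
by rewrite mulrAC ler_pdivrMr// ler_pM2l// lerDl.
Qed.

(** The function [conj psi * u] is allowed in the Neumann formulation: it lies
    in H^1 by the product rule and vanishes outside a box. *)
Lemma neumann_energy_eq0 : 0 <= r -> neumann Om V m a b c u Du F ->
  \int[mu]_(x in Om) energy u Du x = 0.
Proof.
move=> r0 neu.
pose v x := (psi x)^* * u x.
pose Dv i x := (psi x)^* * Du i x + (partial i psi x)^* * u x.
have spsi := smoothJ psi_smooth.
have mspsi := smooth_cmeasurable mOm spsi.
have JB x : sqnormc (psi x)^* <= B by rewrite sqnormcJ.
have dJB i x : sqnormc (partial i (fun y => (psi y)^*) x) <= B.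
  by rewrite partialJ// sqnormcJ.
have mdspsi i := smooth_cmeasurable mOm (smooth_partial i spsi).
have DvE i : Dv i =
    fun x => (psi x)^* * Du i x + partial i (fun y => (psi y)^*) x * u x.
  by apply/funext => x; rewrite partialJ.
(* In a product, x^* denotes Num.conj rather than conjc; they are convertible. *)
have DvJ i x : Num.conj (Dv i x) = psi x * (Du i x)^* + partial i psi x * (u x)^*.
  exact: conjMD.
have E1 x : psi x * (u x)^* = Num.conj (v x) by exact/esym/conjM.
have v2 : L2 mu Om v by exact: (L2M mOm mspsi (fun x _ => JB x)).
have Dv2 i : L2 mu Om (Dv i).
  rewrite DvE; apply: L2D => //; first exact: (L2M mOm mspsi (fun x _ => JB x)).
  exact: (L2M mOm (mdspsi i) (fun x _ => dJB i x)).
have vH1 : H1 Om v Dv.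
  split; first exact/memL2P.
  move=> i; split; first exact/memL2P.
  rewrite DvE; apply: (weak_partialM mOm oOm spsi JB (dJB i)) => //.
  by case: uH1 => _ /(_ i)[].
have vs : exists r' : R, forall x, Om x -> r' < `|x| -> v x = 0.
  exists r => x _; rewrite -[`|x|]/(mx_norm x) mx_normrE => rx.
  have nx : ~ box r x.
    move=> xr; move: rx; rewrite ltNge => /negP; apply.
    by apply: bigmax_le => // -[i j] _ /=; rewrite ord1; exact: xr.
  have := psiB x; rewrite indicE memNset// mulr0 => psi0.
  have psi00 : psi x = 0.
    by apply: eq0_normc; apply/eqP; rewrite normcEsqrt sqrtr_eq0.
  by apply: eq_ReIm; rewrite /v !complex_partE psi00 /=; ring.
have := neu v Dv vH1 vs; rewrite /Cintegral /= => H.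
rewrite Rintegral_energy//; apply/eqP; rewrite subr_eq0; apply/eqP.
rewrite -Rintegral_sum; last first.
- move=> i; rewrite (_ : (fun x => _) = fun x => Re (Du i x * (Dv i x)^*)).
    exact/integrable_ReM/L2J.
  by apply/funext => x; rewrite DvJ.
- exact: mOm.

transitivity (\int[mu]_(x in Om) Re (\sum_i Du i x * (Dv i x)^*) +
  \int[mu]_(x in Om) Re (fu x * (v x)^*)).
  congr (_ + _); apply: eq_Rintegral => x _; last by rewrite E1.
  rewrite Re_sum; apply: eq_bigr => i _.
  by rewrite DvJ.
by rewrite H; apply: eq_Rintegral => x _; rewrite E1.
Qed.

End energy_identity.

(** * Lower bound of the energy and passage to the limit *)

Section limit_bounds.
Context d {T : measurableType d} {R : realType}.
Variables (mu : {measure set T -> \bar R}) (D : set T).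
Hypothesis mD : measurable D.

Lemma ae_le_Rintegral (f g : T -> R) :
  mu.-integrable D (EFin \o f) -> mu.-integrable D (EFin \o g) ->
  (\forall x \ae mu, D x -> f x <= g x) ->
  \int[mu]_(x in D) f x <= \int[mu]_(x in D) g x.
Proof.
move=> fi gi fg; rewrite -subr_ge0 -RintegralB//.
have hi := integrableRB mD gi fi.
rewrite /Rintegral (ae_eq_integral (fun x => (`|g x - f x|)%:E))//.
- by apply: fine_ge0; apply: integral_ge0 => x _; rewrite lee_fin.
- by case/integrableP: hi.
- by case/integrableP: (integrable_norm hi).
- by apply: filterS fg => x fg Dx; rewrite ger0_norm// subr_ge0; exact: fg.
Qed.

(** The bound may depend on [n], so as to carry an error that vanishes only in
    the limit. *)
Lemma fatou_bound (f : nat -> T -> R) (g : T -> R) (b : nat -> R) (l : R) :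
  (forall n, measurable_fun D (f n)) -> (forall n x, D x -> 0 <= f n x) ->
  (forall x, D x -> f n x @[n --> \oo] --> g x) ->
  (forall n, \int[mu]_(x in D) (f n x)%:E <= (b n)%:E)%E ->
  b n @[n --> \oo] --> l ->
  (\int[mu]_(x in D) (g x)%:E <= l%:E)%E.
Proof.
move=> mf f0 fg fb bl.
have := @fatou _ _ _ mu D mD (fun n x => (f n x)%:E).
move=> /(_ (fun n => (measurable_EFinP _ _).2 (mf n)))
  /(_ (fun n x Dx => eqbRL (lee_fin _ _) (f0 n x Dx))).
rewrite (@eq_integral _ _ _ _ _ (fun x => (g x)%:E)); last first.
  move=> x; rewrite inE => Dx; apply: (cvg_limn_einf_sup _).1.
  by apply/fine_cvgP; split; [exact: nearW|exact: fg].
move=> /le_trans; apply.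
have blE : (b n)%:E @[n --> \oo] --> l%:E 
  by apply/fine_cvgP; split; [exact: nearW|exact: bl].
rewrite -(cvg_lim _ blE)// limn_einf_lim; apply: lee_lim.
- exact: is_cvg_einfs.
- by apply/cvg_ex; exists l%:E.
apply: nearW => n; apply: le_trans (fb n).
by apply: ereal_inf_lbound; exists n => /=.
Qed.

End limit_bounds.

Section pointwise_estimates.
Context {R : realType} {N : nat}.
Local Notation E := 'rV[R]_N.
Local Notation C := R[i].
Local Notation mu := (@lebesgue_rV R N).
Local Notation Re := complex.Re.
Local Notation Im := complex.Im.
Implicit Types (n : nat) (lam : R).

(** The real part of [(1 + i lam) z] is [Re z - lam Im z]: testing with this
    weight adds [lam] times the imaginary part of the energy identity, with the
    sign that makes the dissipation positive, to its real part. *)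
Definition weight lam n (x : E) : C := (1 +i* lam) * (cutoff n x)%:C.

Lemma smooth_weight lam n : smooth (weight lam n).
Proof.
by apply: smoothM; [exact: smooth_cst|apply: smooth_real => k; exact: Ck_cutoff].
Qed.

Lemma partial_weight lam n i x : partial i (weight lam n) x =
  (1 +i* lam) * ('D_(basis_rV i) (cutoff n) x)%:C.
Proof.
rewrite partialM; [|exact: smooth_cst|by apply: smooth_real => k; exact: Ck_cutoff].
by rewrite partial_cst mul0r addr0 partial_real.
Qed.

Definition weight_bound lam : R := (1 + lam ^+ 2) * (1 + (4 / flat 0 1) ^+ 2).

Lemma weight_bound_ge0 lam : 0 <= weight_bound lam.
Proof. by rewrite mulr_ge0 ?addr_ge0 ?sqr_ge0. Qed.

Lemma sqnormc_weight_le lam n x :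
  sqnormc (weight lam n x) <= weight_bound lam * \1_(box n.+1%:R) x.
Proof.
have ge1 : 1 <= 1 + (4 / flat 0 1 : R) ^+ 2 by rewrite lerDl sqr_ge0.
have l1 : 0 <= 1 + lam ^+ 2 by rewrite addr_ge0 ?sqr_ge0.
rewrite sqnormcM sqnormc_real {1}/sqnormc /= expr1n indicE.
have [xc|xc] := pselect (box n.+1%:R x).
  rewrite mem_set//= mulr1 ler_wpM2l// (le_trans _ ge1)//.
  by rewrite expr_le1 ?cutoff_ge0 ?cutoff_le1.
rewrite memNset//= mulr0.
have [i xi] : exists i, n.+1%:R < `|x ord0 i|.
  apply/not_existsP => h; apply: xc => i; rewrite leNgt; apply/negP; exact: h.
by rewrite (cutoff_eq0 (ltW xi)) expr0n mulr0.
Qed.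

Lemma sqnormc_partial_weight_le lam n i x :
  sqnormc (partial i (weight lam n) x) <= weight_bound lam.
Proof.
have l1 : 0 <= 1 + lam ^+ 2 by rewrite addr_ge0 ?sqr_ge0.
rewrite partial_weight sqnormcM sqnormc_real {1}/sqnormc /= expr1n.
rewrite ler_wpM2l// -real_normK ?num_real//.
apply: (@le_trans _ _ ((4 / flat 0 1) ^+ 2)); last by rewrite lerDr.
have f0 := @flat0_gt0 R.
rewrite lerXn2r ?nnegrE ?divr_ge0 ?(ltW f0)//.
apply: le_trans (partial_cutoff_le n x i) _.
by rewrite ler_pdivrMr// ler_peMr ?ler1n// divr_ge0// ltW.
Qed.

Lemma sum_affine (s : 'I_N -> R) (x k l p : R) :
  \sum_i (x * s i - k * (l * s i + p)) =
  x * (\sum_i s i) - k * (l * (\sum_i s i) + N%:R * p).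
Proof.
rewrite sumrB -!mulr_sumr big_split /= -mulr_sumr.
by rewrite sumr_const card_ord mulr_natl.
Qed.

(** The imaginary parts of the coefficients, amplified by [lam], dominate the
    signs that their real parts may have. The coefficient of [|u|^2] is asked
    to be 2 so that one unit pays for the right-hand side [F]; the cross terms
    with the gradient of the cutoff carry the small factor [4 / flat 0 1 /
    (n + 1)]. *)
Lemma energy_ge (V : E -> R) (m : R) (a b c : C) (F u : E -> C)
    (Du : 'I_N -> E -> C) (K delta lam : R) n (x : E) :
  0 < m -> 0 <= lam -> complex.Im c <= 0 -> V x ^+ 2 <= K ^+ 2 ->
  delta <= Re a - lam * Im a ->
  2 + `|Re c| * K ^+ 2 <= Re b - lam * Im b ->
  cutoff n x * (sqnormc (u x) + \sum_i sqnormc (Du i x)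
                + delta * normc (u x) `^ (m + 1)) <=
  energy V m a b c F u Du (weight lam n) u Du x
  + (1 + lam ^+ 2) * sqnormc (F x)
  + (4 / flat 0 1 / n.+1%:R) * ((1 + lam ^+ 2) * \sum_i sqnormc (Du i x)
       + N%:R * sqnormc (u x)).
Proof.
move=> m0 lam0 c0 VK ha hb.
have x0 := cutoff_ge0 n x; have x1 := cutoff_le1 n x.
set kap := 4 / _ / _.
have kap0 : 0 <= kap by rewrite !divr_ge0// ltW// flat0_gt0.
set q := normc (u x) `^ (m + 1).
have q0 : 0 <= q by exact: powR_ge0.
have p0 := sqnormc_ge0 (u x); set p := sqnormc (u x) in p0 *.
rewrite energyE.
have grad i : cutoff n x * sqnormc (Du i x)
    - kap * ((1 + lam ^+ 2) * sqnormc (Du i x) + p) <=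
    Re (weight lam n x * Du i x * (Du i x)^*)
    + Re (partial i (weight lam n) x * Du i x * (u x)^*).
  rewrite partial_weight.
  set D := 'D_(basis_rV i) (cutoff n) x.
  have Dk : `|D| <= kap by exact: partial_cutoff_le.
  have -> : Re (weight lam n x * Du i x * (Du i x)^*) =
      cutoff n x * sqnormc (Du i x).
    by rewrite /weight /sqnormc !complex_partE /=; ring.
  have -> : Re ((1 +i* lam) * D%:C * Du i x * (u x)^*) =
      D * Re ((1 +i* lam) * Du i x * (u x)^*).
    by rewrite !complex_partE /=; ring.
  rewrite lerD2l lerNl -mulrN.
  apply: le_trans (ler_norm _) _; rewrite normrM normrN.
  apply: ler_pM => //; apply: le_trans (abs_ReM_le _ _) _.
  by rewrite sqnormcJ sqnormcM {1}/sqnormc /= expr1n.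
have lower : cutoff n x * (2 * p + delta * q) <=
    Re (weight lam n x * nonlinearity V m a b c u x * (u x)^*).
  have qE : q = normc (u x) `^ (- (1 - m)) * p.
    by rewrite /q /p -normcK powR_mul_sqr ?normc_ge0.
  have -> : Re (weight lam n x * nonlinearity V m a b c u x * (u x)^*) =
      cutoff n x * ((Re a - lam * Im a) * q + (Re b - lam * Im b) * p
        + (Re c - lam * Im c) * (V x ^+ 2 * p)).
    rewrite qE /weight /nonlinearity /p /sqnormc !complex_partE /=; ring.
  rewrite ler_wpM2l//.
  have h1 : delta * q <= (Re a - lam * Im a) * q by rewrite ler_wpM2r.
  have h2 : (2 + `|Re c| * K ^+ 2) * p <= (Re b - lam * Im b) * p.
    by rewrite ler_wpM2r.
  have h3 : - (`|Re c| * K ^+ 2 * p) <= (Re c - lam * Im c) * (V x ^+ 2 * p).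
    rewrite mulrA -mulNr ler_wpM2r//.
    apply: (@le_trans _ _ (- (`|Re c| * V x ^+ 2))).
      by rewrite lerN2 ler_wpM2l.
    rewrite -mulNr ler_wpM2r ?sqr_ge0// lerBrDr.
    apply: le_trans (lerNnormlW _) ; last exact: lexx.
    by rewrite gerDl mulr_ge0_le0.
  lra.
have force : Re (weight lam n x * F x * (u x)^*) <=
    cutoff n x * p + (1 + lam ^+ 2) * sqnormc (F x).
  have -> : Re (weight lam n x * F x * (u x)^*) =
     cutoff n x * Re ((1 +i* lam) * F x * (u x)^*).
    by rewrite /weight !complex_partE /=; ring.
  have := abs_ReM_le ((1 +i* lam) * F x) (u x)^*.
  rewrite sqnormcJ sqnormcM {1}/sqnormc /= expr1n => h.
  have s0 : 0 <= (1 + lam ^+ 2) * sqnormc (F x).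
    by rewrite mulr_ge0 ?sqnormc_ge0// addr_ge0 ?sqr_ge0.
  have := le_trans (ler_norm _) h; rewrite -/p => h'.
  apply: (@le_trans _ _ (cutoff n x * ((1 + lam ^+ 2) * sqnormc (F x) + p))).
    by rewrite ler_wpM2l.
  rewrite mulrDr addrC lerD2l -[leRHS]mul1r ler_wpM2r//.
have Gsplit : Re (weight lam n x * (nonlinearity V m a b c u x - F x) * (u x)^*) =
    Re (weight lam n x * nonlinearity V m a b c u x * (u x)^*)
    - Re (weight lam n x * F x * (u x)^*).
  by rewrite -ReN -ReD; congr Re; ring.
have sumgrad : cutoff n x * (\sum_i sqnormc (Du i x))
    - kap * ((1 + lam ^+ 2) * (\sum_i sqnormc (Du i x)) + N%:R * p) <=
    \sum_i (Re (weight lam n x * Du i x * (Du i x)^*)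
    + Re (partial i (weight lam n) x * Du i x * (u x)^*)).
  apply: le_trans (ler_sum _ (fun i _ => grad i)).
  by rewrite (sum_affine (fun i => sqnormc (Du i x))).
rewrite Gsplit.
move: sumgrad lower force; set g := \sum_i sqnormc _; set S := \sum_i (_ + _).
move: (Re (weight lam n x * nonlinearity V m a b c u x * (u x)^*)) => X.
move: (Re (weight lam n x * F x * (u x)^*)) => Y.
move: (sqnormc (F x)) (cutoff n x) => s chi h1 h2 h3.
lra.
Qed.

End pointwise_estimates.

(** * The global estimate and its constant *)

Section energy_estimate.
Context {R : realType} {N : nat}.
Local Notation E := 'rV[R]_N.
Local Notation C := R[i].
Local Notation mu := (@lebesgue_rV R N).
Local Notation Re := complex.Re.
Local Notation Im := complex.Im.

(** With the cutoffs of radius [n + 1], the integral of the energy vanishes and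
    the errors coming from the gradient of the cutoff are of order [1 / n]. In
    the limit the bound is global; for positive [delta] it shows that [u] is in
    L^(m+1), although the power of [u] is only known to be integrable on
    bounded sets beforehand. *)
Lemma energy_estimate (Om : set E) (V : E -> R) (m : R) (a b c : C)
    (F u : E -> C) (Du : 'I_N -> E -> C) (K delta lam : R) :
  open Om -> measurable_fun Om V ->
  (\forall x \ae mu, Om x -> V x ^+ 2 <= K ^+ 2) ->
  0 < m < 1 -> L2 mu Om F -> H1 Om u Du ->
  distributional_solution Om V m a b c u F ->
  H10 Om u Du \/ neumann Om V m a b c u Du F ->
  0 <= lam -> Im c <= 0 -> 0 <= delta -> delta <= Re a - lam * Im a ->
  2 + `|Re c| * K ^+ 2 <= Re b - lam * Im b ->
  (\int[mu]_(x in Om) (sqnormc (u x) + \sum_i sqnormc (Du i x)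
     + delta * normc (u x) `^ (m + 1))%:E
   <= ((1 + lam ^+ 2) * \int[mu]_(x in Om) sqnormc (F x))%:E)%E.
Proof.
move=> oOm mV VK m01 F2 uH1 sol bc lam0 c0 delta0 ha hb.
have mOm := open_measurable_rV oOm.
have m0 : 0 < m by case/andP: m01.
have u2 : L2 mu Om u by apply/memL2P => //; case: uH1.
have Du2 i : L2 mu Om (Du i) by apply/memL2P => //; case: uH1 => _ /(_ i)[].
pose B := weight_bound lam.
have B0 := weight_bound_ge0 lam : 0 <= B.
have sw n := smooth_weight lam n : smooth (weight lam n : E -> C).
have wB n := @sqnormc_weight_le R N lam n.
have dwB n := @sqnormc_partial_weight_le R N lam n.
pose w x := sqnormc (u x) + \sum_i sqnormc (Du i x)
     + delta * normc (u x) `^ (m + 1).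
pose en n := energy V m a b c F u Du (weight lam n) u Du.
have ien n : mu.-integrable Om (EFin \o en n).
  exact: (integrable_energy_H1 _ _ _ oOm mV VK m01 F2 uH1 B0 (sw n) (wB n) (dwB n)).
have en0 n : \int[mu]_(x in Om) en n x = 0.
  case: bc => [h10|neu].
    exact: (dirichlet_energy_eq0 oOm mV VK m01 F2 uH1 B0 (sw n) (wB n) (dwB n)).
  exact: (neumann_energy_eq0 oOm mV VK m01 F2 uH1 B0 (sw n) (wB n) (dwB n) _ neu).
pose g x := \sum_i sqnormc (Du i x).
pose e1 x := (1 + lam ^+ 2) * sqnormc (F x).
pose e2 x := (1 + lam ^+ 2) * g x + N%:R * sqnormc (u x).
pose kap n : R := 4 / flat 0 1 / n.+1%:R.
have ig : mu.-integrable Om (EFin \o g).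
  by apply: integrableR_sum => // i; case: (Du2 i).
have ie1 : mu.-integrable Om (EFin \o e1).
  by apply: integrableRZ => //; case: F2.
have ie2 : mu.-integrable Om (EFin \o e2).
  apply: integrableRD => //; first exact: integrableRZ.
  by apply: integrableRZ => //; case: u2.
have w0 x : 0 <= w x.
  have g0 : 0 <= g x by apply: sumr_ge0 => i _; exact: sqnormc_ge0.
  by apply: addr_ge0; rewrite ?mulr_ge0 ?powR_ge0// addr_ge0 ?sqnormc_ge0.
have mw : measurable_fun Om w.
  apply: measurable_funD.
    apply: measurable_funD; last exact: integrable_measurable ig.
    exact/cmeasurable_sqnormc/(proj1 u2).
  apply: measurable_funM; first exact: measurable_cst.
  apply: (measurableT_comp (measurable_powR (m + 1))).
  by apply: measurable_fun_normc; case: u2.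
have mcut n : measurable_fun Om (cutoff n : E -> R).
  apply: measurable_funTS; apply: continuous_measurable_rV.
  exact: Ck_continuous (Ck_cutoff n 0).
have key n : \forall x \ae mu, Om x ->
    cutoff n x * w x <= en n x + e1 x + kap n * e2 x.
  apply: filterS VK => x /[apply] Vx.
  exact: (@energy_ge R N V m a b c F u Du K delta lam n x m0 lam0 c0 Vx ha hb).
have irhs n : mu.-integrable Om (EFin \o (fun x => en n x + e1 x + kap n * e2 x)).
  by apply: integrableRD => //; [exact: integrableRD|exact: integrableRZ].
have mcw n : measurable_fun Om (fun x => cutoff n x * w x).
  exact: measurable_funM.
have cw0 n x : 0 <= cutoff n x * w x by rewrite mulr_ge0 ?cutoff_ge0.
have icw n : mu.-integrable Om (EFin \o (fun x => cutoff n x * w x)).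
  apply: (ae_le_Rintegrable mOm (mcw n) (irhs n)).
  by apply: filterS (key n) => x /[apply] h; rewrite ger0_norm.
pose S := \int[mu]_(x in Om) e1 x.
apply: (@fatou_bound _ _ _ mu Om mOm (fun n x => cutoff n x * w x) w
  (fun n => S + kap n * \int[mu]_(x in Om) e2 x)) => //.
- move=> x _; rewrite -[X in _ --> X]mul1r.
  by apply: cvgM; [exact: cutoff_cvg|exact: cvg_cst].
- move=> n; rewrite -(fineK (integrable_fin_num mOm (icw n))) lee_fin.
  apply: le_trans (ae_le_Rintegral mOm (icw n) (irhs n) (key n)) _.
  rewrite RintegralD//; [|exact: integrableRD|exact: integrableRZ].
  rewrite RintegralD// en0 add0r RintegralZl//.
- have h := @cvg_harmonic R.
  have := cvgD (cvg_cst S) (cvgM (cvgM (cvg_cst (4 / flat 0 1 : R)) h)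
    (cvg_cst (\int[mu]_(x in Om) e2 x))).
  rewrite mulr0 mul0r addr0 /S RintegralZl//; first by apply.
  by case: F2.
Qed.

End energy_estimate.

Section constant.
Context {R : realType}.
Local Notation C := R[i].
Local Notation Re := complex.Re.
Local Notation Im := complex.Im.

(** The topology of the complex numbers has balls whose radii are themselves
    complex; real radii suffice. *)
Lemma continuous_lipschitz (h : C -> R) :
  (forall z w, `|h z - h w| <= normc (z - w)) -> continuous h.
Proof.
move=> h1 z; have FF : Filter (nbhs z) by exact: nbhs_filter.
apply: (@cvgrPdist_lt _ _ _ (nbhs z) FF _ _).2 => e e0.
suff : nbhs z [set w | `|h z - h w| < e] by [].
rewrite -nbhs_ballE; exists e%:C => /=; first by rewrite ltcR.
move=> w; rewrite /ball /= normc_def ltcR => zw.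
by apply: le_lt_trans (h1 z w) _; rewrite normcEsqrt.
Qed.

Lemma Re_continuous : continuous (fun z : C => Re z).
Proof.
apply: continuous_lipschitz => z w; rewrite -ReN -ReD normcEsqrt -sqrtr_sqr.
by rewrite ler_sqrt ?sqnormc_ge0// lerDl sqr_ge0.
Qed.

Lemma Im_continuous : continuous (fun z : C => Im z).
Proof.
apply: continuous_lipschitz => z w; rewrite -ImN -ImD normcEsqrt -sqrtr_sqr.
by rewrite ler_sqrt ?sqnormc_ge0// lerDr sqr_ge0.
Qed.

Lemma normc_continuous : continuous (fun z : C => normc z).
Proof.
have sq : continuous (@sqnormc R).
  have -> : @sqnormc R = (fun z => Re z * Re z + Im z * Im z).
    by apply/funext => z; rewrite -!expr2.
  have cR := Re_continuous; have cI := Im_continuous.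
  by move=> z; exact: cvgD (cvgM (cR z) (cR z)) (cvgM (cI z) (cI z)).
move=> z; under eq_fun do rewrite normcEsqrt.
by apply: (@continuous_comp _ _ _ (@sqnormc R)); [exact: sq|exact: sqrt_continuous].
Qed.

(** The choice of [lam], where [K] bounds the square of [V]. The first summand
    turns the coefficient of [|u|^(m+1)] into at least [|a|], because
    [Re a + (Im a)^2 / (|a| + Re a) = |a|]; its denominator is positive exactly
    when [a] is not a nonpositive real number. The second summand absorbs
    the contributions of [b] and [c]. *)
Definition multiplier (K : R) (p : C * C * C) : R :=
  - Im p.1.1 / (normc p.1.1 + Re p.1.1)
  + (`|Re p.1.2| + `|Re p.2| * K + 2) / (- Im p.1.2).

(** The factor [1 + 1 / |a|] undoes the weight [|a|] of [|u|^(m+1)]; the rest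
    is the factor of [K^2 + 1] in an upper bound of [1 + lam^2]. *)
Definition stability_constant (p : C * C * C) : R :=
  (1 + (normc p.1.1)^-1) * (2 * (1 + multiplier 1 p ^+ 2)).

Lemma admissible_gt0 (a b c : C) : admissible a b c ->
  0 < normc a /\ 0 < normc a + Re a.
Proof.
case=> ia _ _ ha; have sa : normc a ^+ 2 = Re a ^+ 2 + Im a ^+ 2.
  by rewrite normcK.
have n0 := normc_ge0 a.
have [ra|ra] := ltP 0 (Re a).
  have := sqr_ge0 (Im a) => i0.
  suff n1 : 0 < normc a by split=> //; lra.
  rewrite lt_neqAle n0 andbT eq_sym; apply/eqP => na.
  by move: sa; rewrite na; nra.
have ia0 := ha ra.
suff h : 0 < normc a + Re a by split=> //; lra.
rewrite ltNge; apply/negP => h.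
by nra.
Qed.

Lemma multiplier_ge0 (K : R) a b c : 0 <= K -> admissible a b c ->
  0 <= multiplier K (a, b, c).
Proof.
move=> K0 adm; have [n0 n1] := admissible_gt0 adm; case: adm => ia ib _ _.
apply: addr_ge0; apply: divr_ge0; rewrite /= ?oppr_ge0 ?(ltW ib) ?(ltW n1)//.
by rewrite !addr_ge0 ?mulr_ge0.
Qed.

Lemma multiplier_Re_a (K : R) a b c : 0 <= K -> admissible a b c ->
  normc a <= Re a - multiplier K (a, b, c) * Im a.
Proof.
move=> K0 adm; have [n0 n1] := admissible_gt0 adm; case: adm => ia ib _ _.
have sa : normc a ^+ 2 = Re a ^+ 2 + Im a ^+ 2 by rewrite normcK.
rewrite /multiplier /= mulrDl opprD addrA.
have -> : Re a - - Im a / (normc a + Re a) * Im a = normc a.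
  have n1' : normc a + Re a != 0 by rewrite gt_eqF.
  apply: (mulIf n1').
  have : - Im a / (normc a + Re a) * (normc a + Re a) = - Im a by rewrite divfK.
  set t := - Im a / _ => ts.
  have -> : (Re a - t * Im a) * (normc a + Re a) =
      Re a * (normc a + Re a) - t * (normc a + Re a) * Im a by ring.
  by rewrite ts; move: sa; rewrite !expr2 => sa; lra.
rewrite lerDl -mulrN mulr_ge0 ?oppr_ge0// divr_ge0 ?oppr_ge0 ?(ltW ib)//.
by rewrite !addr_ge0 ?mulr_ge0.
Qed.

Lemma multiplier_Re_b (K : R) a b c : 0 <= K -> admissible a b c ->
  2 + `|Re c| * K <= Re b - multiplier K (a, b, c) * Im b.
Proof.
move=> K0 adm; have [n0 n1] := admissible_gt0 adm; case: adm => ia ib _ _.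
rewrite -mulrN /multiplier /= mulrDl divfK ?gt_eqF ?oppr_gt0//.
have : 0 <= - Im a / (normc a + Re a) * - Im b.
  by rewrite mulr_ge0 ?oppr_ge0 ?(ltW ib)// divr_ge0 ?oppr_ge0// ltW.
have := lerNnormlW (lexx `|Re b|).
by lra.
Qed.

(** Isolates the dependence on the potential, leaving a function of the three
    coefficients alone. *)
Lemma multiplier_le (K : R) a b c : 0 <= K -> admissible a b c ->
  multiplier K (a, b, c) <= (1 + K) * multiplier 1 (a, b, c).
Proof.
move=> K0 adm; have [n0 n1] := admissible_gt0 adm; case: adm => ia ib _ _.
rewrite /multiplier /= mulrDr; apply: lerD.
  by rewrite ler_peMl ?lerDl// divr_ge0 ?oppr_ge0// ltW.
rewrite mulrA ler_wpM2r ?invr_ge0 ?oppr_ge0 ?(ltW ib)//.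
have := normr_ge0 (Re b); have := normr_ge0 (Re c); nra.
Qed.

Lemma stability_constant_gt0 a b c : admissible a b c ->
  0 < stability_constant (a, b, c).
Proof.
move=> adm; have [n0 _] := admissible_gt0 adm.
by rewrite /stability_constant /= mulr_gt0 ?ltr_wpDr ?invr_ge0 ?sqr_ge0 ?(ltW n0)//
  mulr_gt0// ltr_wpDr ?sqr_ge0.
Qed.

Lemma stability_constant_continuous :
  {within [set p : C * C * C | admissible p.1.1 p.1.2 p.2],
    continuous stability_constant}.
Proof.
apply: continuous_in_subspaceT => p; rewrite inE => adm.
have [n0 n1] := admissible_gt0 adm; case: adm => ia ib _ _.
have ca (h : C -> R) : continuous h ->
    {for p, continuous (fun p : C * C * C => h p.1.1)}.
  move=> ch; apply: (@continuous_comp _ _ _ (fun p : C * C * C => p.1.1) h).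
    by apply: (@cvg_comp _ _ _ fst fst); [exact: cvg_fst|exact: cvg_fst].
  exact: ch.
have cb (h : C -> R) : continuous h ->
    {for p, continuous (fun p : C * C * C => h p.1.2)}.
  move=> ch; apply: (@continuous_comp _ _ _ (fun p : C * C * C => p.1.2) h).
    by apply: (@cvg_comp _ _ _ fst snd); [exact: cvg_fst|exact: cvg_snd].
  exact: ch.
have cc (h : C -> R) : continuous h ->
    {for p, continuous (fun p : C * C * C => h p.2)}.
  move=> ch; apply: (@continuous_comp _ _ _ (fun p : C * C * C => p.2) h).
    exact: cvg_snd.
  exact: ch.
have nc := normc_continuous; have rc := Re_continuous; have ic := Im_continuous.
have s0 : normc p.1.1 + Re p.1.1 != 0 by rewrite gt_eqF.
have b0 : - Im p.1.2 != 0 by rewrite gt_eqF// oppr_gt0.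
have cm : {for p, continuous (multiplier 1)}.
  apply: (cvgD (cvgM (cvgN (ca _ ic)) (cvgV s0 (cvgD (ca _ nc) (ca _ rc))))).
  apply: (cvgM _ (cvgV b0 (cvgN (cb _ ic)))).
  apply: (cvgD (cvgD (cvg_norm (cb _ rc)) _) (cvg_cst _)).
  exact: (cvgM (cvg_norm (cc _ rc)) (cvg_cst _)).
have na : normc p.1.1 != 0 by rewrite gt_eqF.
apply: (cvgM (cvgD (cvg_cst _) (cvgV na (ca _ nc)))).
apply: (cvgM (cvg_cst _) (cvgD (cvg_cst _) _)).
exact: (cvgM cm cm).
Qed.

End constant.

Theorem theorem2p6 (R : realType) :
  exists M : R[i] * R[i] * R[i] -> R,
    [/\ {within [set p | admissible p.1.1 p.1.2 p.2], continuous M},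
        forall p, admissible p.1.1 p.1.2 p.2 -> 0 < M p &
        forall (N : nat) (Om : set 'rV[R]_N) (V : 'rV[R]_N -> R) (m : R)
          (a b c : R[i]) (F u : 'rV[R]_N -> R[i])
          (Du : 'I_N -> 'rV[R]_N -> R[i]),
        (0 < N)%N -> open Om -> Om !=set0 ->
        memL Om +oo%E (fun x => (V x)%:C) ->
        0 < m < 1 ->
        admissible a b c ->
        memL Om 2%:E F ->
        H1 Om u Du ->
        distributional_solution Om V m a b c u F ->
        H10 Om u Du \/ (C1_boundary Om /\ neumann Om V m a b c u Du F) ->
        (sqnormH1 Om u Du + normL Om (m + 1)%:E u `^ (m + 1)
          <= (M (a, b, c))%:E * (normL Om +oo%E (fun x => (V x)%:C) ^+ 4 + 1)
             * normL Om 2%:E F ^+ 2)%E].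
Proof.
exists stability_constant; split.
- exact: stability_constant_continuous.
- by case=> [[a b] c] adm; exact: stability_constant_gt0.
move=> N Om V m a b c F u Du _ oOm _ VLoo m01 adm F2 uH1 sol bc.
have mOm := open_measurable_rV oOm.
have [K [K0 nVK mV VK]] := memL_pinfty VLoo.
have F2' : L2 (lebesgue_rV N) Om F by exact/memL2P.
have u2 : L2 (lebesgue_rV N) Om u by apply/memL2P => //; case: uH1.
have Du2 i : L2 (lebesgue_rV N) Om (Du i).
  by apply/memL2P => //; case: uH1 => _ /(_ i)[].
have bc' : H10 Om u Du \/ neumann Om V m a b c u Du F.
  by case: bc => [|[]]; [left|right].
have KK0 : 0 <= K ^+ 2 by exact: sqr_ge0.
have [n0 _] := admissible_gt0 adm.
have lam0 := multiplier_ge0 KK0 adm.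
have c0 : complex.Im c <= 0 by case: adm.
have := energy_estimate oOm mV VK m01 F2' uH1 sol bc' lam0 c0 (ltW n0)
  (multiplier_Re_a KK0 adm) (multiplier_Re_b KK0 adm).
set lam := multiplier _ _ in lam0 *.
set S := \int[_]_(x in Om) _ => main.
have m1 : m + 1 != 0 by case/andP: m01 => m0 _; rewrite gt_eqF// addr_gt0.
have iS : (normL Om 2%:E F ^+ 2 = S%:E)%E.
  by rewrite sqr_normL2 /S /Rintegral fineK// integrable_fin_num//; case: F2'.
rewrite sqnormH1E// powR_normL// nVK iS.
have S0 : 0 <= S by apply: Rintegral_ge0 => x _; exact: sqnormc_ge0.
have ip : (lebesgue_rV N).-integrable Om (EFin \o
    (fun x => sqnormc (u x) + \sum_i sqnormc (Du i x))).
  apply: integrableRD => //; first by case: u2.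
  by apply: integrableR_sum => // i; case: (Du2 i).
have p0 x : 0 <= sqnormc (u x) + \sum_i sqnormc (Du i x).
  by rewrite addr_ge0 ?sqnormc_ge0// sumr_ge0// => i _; exact: sqnormc_ge0.
have mq : measurable_fun Om (fun x => normc (u x) `^ (m + 1)).
  apply: (measurableT_comp (measurable_powR (m + 1))).
  by apply: measurable_fun_normc; case: u2.
rewrite {1}/Rintegral fineK ?integrable_fin_num//.
rewrite -ge0_integralD//; last 4 first.
- by move=> x _; rewrite lee_fin.
- by case/integrableP: ip.
- by move=> x _; rewrite lee_fin powR_ge0.
- exact/measurable_EFinP.
pose w x := sqnormc (u x) + \sum_i sqnormc (Du i x)
  + normc a * normc (u x) `^ (m + 1).
have w0 x : 0 <= w x by rewrite addr_ge0// mulr_ge0 ?powR_ge0// ltW.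
have mw : measurable_fun Om w.
  apply: measurable_funD; first exact: integrable_measurable ip.
  by apply: measurable_funM => //; exact: measurable_cst.
have k0 : 0 <= 1 + (normc a)^-1 by rewrite addr_ge0// invr_ge0 ltW.
apply: (@le_trans _ _
  (\int[lebesgue_rV N]_(x in Om) ((1 + (normc a)^-1)%:E * (w x)%:E)))%E.
  apply: ge0_le_integral => //.
  - by move=> x _; rewrite -EFinD lee_fin addr_ge0 ?powR_ge0.
  - apply: emeasurable_funD; [by case/integrableP: ip|exact/measurable_EFinP].
  - by apply: measurable_funeM; exact/measurable_EFinP.
  move=> x _; rewrite -EFinD -EFinM lee_fin /w.
  have q0 := powR_ge0 (normc (u x)) (m + 1); have := p0 x.
  move: (_ `^ _) q0 (sqnormc _ + _) => q q0 p px.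
  have -> : (1 + (normc a)^-1) * (p + normc a * q) =
      p + q + ((normc a)^-1 * p + normc a * q) by field; rewrite gt_eqF.
  by rewrite lerDl addr_ge0// mulr_ge0 ?invr_ge0 ?(ltW n0).
rewrite ge0_integralZl_EFin//; last 2 first.
- by move=> x _; rewrite lee_fin.
- exact/measurable_EFinP.
apply: le_trans (lee_wpmul2l _ main) _; first by rewrite lee_fin.
rewrite -EFin_expe -EFinD -!EFinM lee_fin /stability_constant /=.
have mul1 := multiplier_ge0 ler01 adm.
have lamle := multiplier_le KK0 adm.
rewrite -!mulrA ler_wpM2l// !mulrA ler_wpM2r//.
set l := multiplier 1 _ in mul1 lamle *.
have l2 : lam ^+ 2 <= ((1 + K ^+ 2) * l) ^+ 2.
  have kl0 : 0 <= (1 + K ^+ 2) * l by rewrite mulr_ge0// addr_ge0.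
  by rewrite lerXn2r ?nnegrE.
apply: (@le_trans _ _ (1 + ((1 + K ^+ 2) * l) ^+ 2)); first by rewrite lerD2l.
have -> : K ^+ 4 = (K ^+ 2) ^+ 2 by rewrite -exprM.
move: (K ^+ 2) KK0 => k kk0; have l20 := sqr_ge0 l; have := sqr_ge0 (1 - k).
rewrite exprMn; move: (l ^+ 2) l20 => z z0 h.
have h2 : (1 + k) ^+ 2 <= 2 * (k ^+ 2 + 1) by nra.
have h3 : (1 + k) ^+ 2 * z <= 2 * (k ^+ 2 + 1) * z by rewrite ler_wpM2r.
have h4 := sqr_ge0 k.
by nra.
Qed.
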